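(* Consider the inclusion process on a finite set $S$ with underlying rates $r$ and parameter $d_N$ with $\lim_{N\to\infty}d_N\log N=0$, and suppose the process exhibits condensation. (a) If $S_0$ has only one irreducible component, then $S_\star=S_0$ and $\lim_{N\to\infty}\mu_N(\xi_N^x)=\nu(x)$ for all $x\in S_\star$, where $\nu$ is the unique invariant probability measure of the (irreducible) continuous-time Markov chain on $S_\star$ with rates $a(x,y)=[r(x,y)-r(y,x)]\mathbf 1\{r(x,y)>r(y,x)\}$. (b) If $r(x,y)=r(y,x)$ for all $x,y\in S_0$, the continuous-time Markov chain on $S_0$ with rates $r(x,y)$ is irreducible, and $S_0$ is attracting, then $S_\star=S_0$ and $\lim_{N\to\infty}\mu_N(\xi_N^x)=\nu(x)$ for all $x\in S_\star$, where $\nu$ is the unique invariant probability measure of the continuous-time Markov chain on $S_\star$ with rates $r(x,y)$.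
   Context: $S$ is finite; $r:S\times S\to[0,\infty)$, $r(x,x)=0$, are the rates of an irreducible continuous-time Markov chain on $S$. $\mathcal H_N=\{\eta\in\{0,1,2,\dots\}^S:\sum_x\eta_x=N\}$; $\sigma^{x,y}\eta$ moves one particle from $x$ to $y$ (if $\eta_x\ge1$; else $\sigma^{x,y}\eta=\eta$). With $d_N>0$, $d_N\to0$, the inclusion process has generator $(\mathcal L_NF)(\eta)=\sum_{x\ne y}\eta_x(d_N+\eta_y)r(x,y)\{F(\sigma^{x,y}\eta)-F(\eta)\}$ on $\mathcal H_N$ and unique invariant probability measure $\mu_N$. $\xi_N^x$: configuration with all $N$ particles at $x$; $\mathcal E_N=\{\xi_N^x:x\in S\}$. Condensation: $\lim_N\mu_N(\mathcal E_N)=1$; $S_\star=\{x:\limsup_N\mu_N(\{\xi_N^x\})>0\}$. $S_0$: recurrent states of the Markov chain $Z_1$ on $S$ with rates $b(x,y)=[r(x,y)-r(y,x)]\mathbf 1\{r(x,y)>r(y,x)\}$; ''$S_0$ has only one irreducible component'' means $Z_1$ restricted to $S_0$ is irreducible (for all $x,y\in S_0$ there is a path $x=z_0,z_1,\dots,z_k=y$ in $S_0$ with $\prod b(z_{i-1},z_i)>0$). $A\subseteq S$ is attracting if $r(x,y)<r(y,x)$ for all $x\in A$, $y\notin A$ with $r(x,y)+r(y,x)>0$. *)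

(* Defs.v *)
From HB Require Import structures.
From mathcomp Require Import all_boot all_order all_algebra.
From mathcomp Require Import all_classical all_reals all_analysis.
Set Implicit Arguments. Unset Strict Implicit. Unset Printing Implicit Defensive.
Import Order.TTheory GRing.Theory Num.Theory.
Import numFieldNormedType.Exports.
Local Open Scope classical_set_scope.
Local Open Scope ring_scope.

Section Inclusion.
Variable R : realType.
Variable S : finType.

Definition config (N : nat) := {ffun S -> 'I_N.+1}.

Definition HN (N : nat) : {set config N} :=
  [set eta : config N | (\sum_(x : S) (eta x : nat) == N)%N].

Definition sigma (N : nat) (x y : S) (eta : config N) : config N :=
  if (x != y) && (0 < (eta x : nat))%N then
    [ffun z => if z == x then inord (eta x).-1
               else if z == y then inord (eta y).+1 else eta z]
  else eta.

Definition gen (r : S -> S -> R) (d : R) (N : nat)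
    (F : config N -> R) (eta : config N) : R :=
  \sum_(x : S) \sum_(y : S | y != x)
     (eta x : nat)%:R * (d + (eta y : nat)%:R) * r x y
       * (F (sigma x y eta) - F eta).

Definition invariant_prob (r : S -> S -> R) (d : R) (N : nat)
    (mu : config N -> R) : Prop :=
  [/\ forall eta, 0 <= mu eta,
      forall eta, eta \notin HN N -> mu eta = 0,
      \sum_(eta : config N) mu eta = 1
    & forall F : config N -> R,
        \sum_(eta in HN N) mu eta * gen r d F eta = 0].

Definition xi (N : nat) (x : S) : config N :=
  [ffun z => if z == x then ord_max else ord0].

Definition EN (N : nat) : {set config N} := [set xi N x | x : S].

Definition brate (r : S -> S -> R) (x y : S) : R :=
  if r y x < r x y then r x y - r y x else 0.

Definition posrel (q : S -> S -> R) : rel S :=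
  [rel x y | (x != y) && (0 < q x y)].

Definition recurrent_set (q : S -> S -> R) : {set S} :=
  [set x | [forall y, connect (posrel q) x y ==> connect (posrel q) y x]].

Definition Szero (r : S -> S -> R) : {set S} := recurrent_set (brate r).

Definition irreducible_on (q : S -> S -> R) (A : {set S}) : Prop :=
  forall x y, x \in A -> y \in A ->
    connect [rel u v | [&& u \in A, v \in A & posrel q u v]] x y.

Definition attracting (r : S -> S -> R) (A : {set S}) : Prop :=
  forall x y, x \in A -> y \notin A -> 0 < r x y + r y x -> r x y < r y x.

Definition invariant_prob_on (q : S -> S -> R) (A : {set S}) (nu : S -> R)
    : Prop :=
  [/\ forall x, 0 <= nu x,
      forall x, x \notin A -> nu x = 0,
      \sum_(x : S) nu x = 1
    & forall y, y \in A ->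
        \sum_(x in A | x != y) nu x * q x y
        = nu y * \sum_(z in A | z != y) q y z].

(* x in S_star : limsup_N mu_N(xi_N^x) > 0 (unfolded). *)
Definition in_Sstar (mu : forall N, config N -> R) (x : S) : Prop :=
  exists2 eps : R, 0 < eps &
    forall M : nat, exists2 N : nat, (M <= N)%N & eps < mu N (xi N x).

Definition conclusion (mu : forall N, config N -> R) (A : {set S})
    (q : S -> S -> R) : Prop :=
  (forall x, in_Sstar mu x <-> x \in A) /\
  (exists nu, invariant_prob_on q A nu) /\
  (forall nu, invariant_prob_on q A nu ->
     forall x, x \in A -> (fun N => mu N (xi N x)) @ \oo --> nu x).

End Inclusion.

(* Main.v *)
Require Import Defs.
From HB Require Import structures.
From mathcomp Require Import all_boot all_order all_algebra.
From mathcomp Require Import all_classical all_reals all_analysis.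
From mathcomp Require Import ring lra zify.
Set Implicit Arguments. Unset Strict Implicit. Unset Printing Implicit Defensive.
Import Order.TTheory GRing.Theory Num.Theory.
Import numFieldNormedType.Exports.
Local Open Scope classical_set_scope.
Local Open Scope ring_scope.

(** If [\sum_x mu_N(xi^x) (Q f)(x) -> 0] for every [f], where [Q] generates an
    irreducible chain on [A] and the masses [mu_N(xi^x)], x in A, sum to 1 in the
    limit, then solving the Poisson equation [Q f = 1_x - c] gives [mu_N(xi^x) -> c],
    and these limits form the unique invariant probability of [Q].

    Time scale 1 / (N d): extend f from the condensed configurations xi^x to a
    function F with L F = d F elsewhere.  Along the tube of configurations with
    N - k particles at x and k at y, the increments D_k of F satisfy
    |r(x,y) D_k - r(y,x) D_(k-1)| <= C d N / (k (N - k)); these errors sum to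
    O(d ln N), so r(x,y) D_0 = b(x,y) (f y - f x) + o(1), and stationarity of mu_N
    tested on F yields the hypothesis above for the rates b.  In particular the
    condensate is not found at a transient state of b, and part (a) follows.

    Time scale 1 / d (part (b), with A = S_0): let m be the number of particles
    outside A, f_A = \sum_(x in A) f(x) eta_x, and test stationarity on
    f_A (N + m) / N^2.  By symmetry of r on A the moves inside A contribute
    d (Q f)(x) + o(d) at xi^x; by the choice of the factor N + m the moves across
    the boundary of A are negligible, unless m is large or two sites of A are
    occupied.  Let W be the total rate of particles returning to A.  Since A is
    attracting, the Lyapunov functions m, \sum_(j < m) min(j / M, 1) and
    min(m, M) 1{two sites of A occupied} bound the expectation of W, of W on
    {m >= M} and of W on {two sites of A occupied, m <= M}, and condensation makes
    the last two o(d N) as N and then M tend to infinity. *)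

(** In finite dimension a trivial kernel forces surjectivity. The linear systems below are all
    solved this way, uniqueness coming from a maximum principle; linearity is stated pointwise so
    that [L] can be defined by cases on plain functions. *)
Lemma injective_linear_surjective (R : fieldType) (T : finType)
    (L : (T -> R) -> T -> R) :
  (forall a f g x, L (fun t => a * f t + g t) x = a * L f x + L g x) ->
  (forall f, (forall x, L f x = 0) -> forall x, f x = 0) ->
  forall g, exists f, forall x, L f x = g x.
Proof.
move=> Llin Linj g.
pose L' (f : {ffun T -> R^o}) : {ffun T -> R^o} := [ffun x => L f x].
have L'lin : linear L'.
  move=> a u v; apply/ffunP => x; rewrite !ffunE /= -Llin.
  by congr (L _ x); apply: funext => t; rewrite !ffunE.
pose h : {linear {ffun T -> R^o} -> {ffun T -> R^o}} :=
  HB.pack L' (GRing.isLinear.Build _ _ _ _ L' L'lin).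
have ker0 : lker (linfun h) == 0%VS.
  rewrite -subv0; apply/subvP => f; rewrite memv_ker lfunE /= => /eqP hf.
  rewrite memv0; apply/eqP/ffunP => x; rewrite ffunE.
  by apply: Linj => t; move/ffunP/(_ t): hf; rewrite !ffunE.
have : (finfun g : {ffun T -> R^o}) \in limg (linfun h)
  by rewrite (lker0_limgf ker0) memvf.
case/memv_imgP => f _ /ffunP gE; exists f => x.
by move: (gE x); rewrite lfunE /= !ffunE.
Qed.

(** * One-dimensional recursions for increments, and harmonic sums *)

Section Recursion.
Variable R : realType.

(* If a D_0 exceeds the total error E, then all D_k stay positive and
   a D_k >= a D_0 - E. *)
Lemma increments_lower_bound (D e : nat -> R) (n : nat) (a b : R) :
  0 <= a -> a <= b -> (forall k, 0 <= e k) ->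
  (forall k, (k < n)%N -> b * D k - e k <= a * D k.+1) ->
  a * D 0%N <= a * `|\sum_(k < n.+1) D k| / n.+1%:R + \sum_(k < n) e k.
Proof.
move=> a0 ab e0 H; set E := \sum_(k < n) e k.
have S0 : 0 <= a * `|\sum_(k < n.+1) D k| / n.+1%:R.
  by rewrite divr_ge0 // mulr_ge0.
have E0 : 0 <= E by rewrite sumr_ge0.
have [aE|Ea] := leP (a * D 0%N) E.
  by apply: le_trans aE _; rewrite lerDr.
have a_gt0 : 0 < a.
  by rewrite lt_neqAle a0 andbT eq_sym; apply/eqP => az; rewrite az mul0r in Ea; lra.
have partE k : (k <= n)%N -> \sum_(j < k) e j <= E.
  move=> kn; rewrite /E -(subnKC kn) big_split_ord /= lerDl sumr_ge0 //.
have DE k : (k <= n)%N -> a * D 0%N - \sum_(j < k) e j <= a * D k.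
  elim: k => [|k IH] kn; first by rewrite big_ord0; lra.
  rewrite big_ord_recr /=; have := IH (ltnW kn); have := H _ kn.
  have := partE _ (ltnW kn) => h1 h2 h3.
  have Dk0 : 0 <= D k by rewrite -(pmulr_rge0 _ a_gt0); lra.
  have : a * D k <= b * D k by rewrite ler_wpM2r.
  by lra.
have : \sum_(k < n.+1) (a * D 0%N - E) <= \sum_(k < n.+1) (a * D k).
  apply: ler_sum => k _; have kn : (k <= n)%N by rewrite -ltnS.
  by have := DE _ kn; have := partE _ kn; lra.
rewrite sumr_const card_ord -mulr_sumr -mulr_natr => h.
have : a * \sum_(k < n.+1) D k <= a * `|\sum_(k < n.+1) D k|.
  by rewrite ler_wpM2l // ler_norm.
move=> h'; rewrite -lerBlDr ler_pdivlMr //; lra.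
Qed.

(** The hypothesis is invariant under changing the sign of [D], so the one-sided bound applies to
    whichever of [D] and [-D] starts nonnegative. *)
Lemma increments_bound (D e : nat -> R) (n : nat) (a b : R) :
  0 <= a -> a <= b -> (forall k, 0 <= e k) ->
  (forall k, (k < n)%N -> `|a * D k.+1 - b * D k| <= e k) ->
  a * `|D 0%N| <= a * `|\sum_(k < n.+1) D k| / n.+1%:R + \sum_(k < n) e k.
Proof.
move=> a0 ab e0 H.
have [D0|D0] := ger0P (D 0%N).
  apply: increments_lower_bound ab e0 _ => // k kn.
  by have := H _ kn; rewrite ler_norml => /andP[]; lra.
rewrite -[X in a * X / _]normrN -sumrN.
apply: (@increments_lower_bound (fun k => - D k) e n a b) => // k kn.
by have := H _ kn; rewrite ler_norml => /andP[]; lra.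
Qed.

(** Here [p] and [q] stand for r(x,y) and r(y,x). If p <= q the first increment is itself small. If
    q < p the last one is small, and summing the recursion gives p (De - D_0) = q (De - D_n) up to
    the total error, hence p D_0 is close to (p - q) De. *)
Lemma first_increment_estimate (F e : nat -> R) (n : nat) (p q : R) :
  0 <= p -> 0 <= q -> (forall k, 0 <= e k) ->
  (forall k, (k < n)%N ->
     `|p * (F k.+2 - F k.+1) - q * (F k.+1 - F k)| <= e k) ->
  `|p * (F 1%N - F 0%N) - (if q < p then p - q else 0) * (F n.+1 - F 0%N)|
  <= (p + q) * `|F n.+1 - F 0%N| / n.+1%:R + 2 * \sum_(k < n) e k.
Proof.
move=> p0 q0 e0 H; pose D k := F k.+1 - F k.
have sumD : \sum_(k < n.+1) D k = F n.+1 - F 0%N.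
  by rewrite -(big_mkord xpredT D) telescope_sumr.
set E := \sum_(k < n) e k; set De := F n.+1 - F 0%N.
have E0 : 0 <= E by rewrite sumr_ge0.
have tp : 0 <= p * `|De| / n.+1%:R by rewrite divr_ge0 // mulr_ge0.
have tq : 0 <= q * `|De| / n.+1%:R by rewrite divr_ge0 // mulr_ge0.
rewrite !mulrDl; set P := p * `|De| / _ in tp *; set Q := q * `|De| / _ in tq *.
case: ltP => [qp|pq]; last first.
  rewrite mul0r subr0 normrM (ger0_norm p0).
  by have := increments_bound p0 pq e0 H; rewrite -/E sumD -/De -/P; lra.
(* Read backwards, the increments satisfy the same kind of recursion with [p] and [q] exchanged, so
   [increments_bound] controls [D n]. *)
have revH k : (k < n)%N ->
    `|q * D (n - k.+1)%N - p * D (n - k)%N| <= e (n - k.+1)%N.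
  move=> kn; have jn : (n - k.+1 < n)%N by lia.
  by have := H _ jn; rewrite subnSK // distrC /D subnSK.
have := @increments_bound (fun k => D (n - k)%N) (fun k => e (n - k.+1)%N) n
  q p q0 (ltW qp) (fun k => e0 _) revH.
have -> : \sum_(k < n.+1) D (n - k)%N = De.
  rewrite /De -sumD (reindex_inj rev_ord_inj); apply: eq_bigr => k _ /=.
  by rewrite subSS subKn // -ltnS.
have -> : \sum_(k < n) e (n - k.+1)%N = E.
  rewrite (reindex_inj rev_ord_inj); apply: eq_bigr => k _ /=.
  by rewrite subnSK // subKn // ltnW.
rewrite subn0 -/Q => hD.
have sumH : `|p * (De - D 0%N) - q * (De - D n)| <= E.
  have -> : De - D 0%N = \sum_(k < n) D k.+1.
    by rewrite /De -sumD big_ord_recl /= addrAC subrr add0r.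
  have -> : De - D n = \sum_(k < n) D k.
    by rewrite /De -sumD big_ord_recr /= addrK.
  rewrite !mulr_sumr -sumrB.
  apply: le_trans (ler_norm_sum _ _ _) _; apply: ler_sum => k _.
  exact: H.
have hqD : `|q * D n| <= Q + E.
  by rewrite normrM (ger0_norm q0).
move: sumH hqD; rewrite -/(D 0%N) !ler_norml => /andP[h1 h2] /andP[h3 h4].
by apply/andP; split; lra.
Qed.

Lemma harmonic_sum_le_ln (n : nat) :
  \sum_(k < n.+1) (k.+1%:R : R)^-1 <= 1 + ln n.+1%:R.
Proof.
elim: n => [|n IH]; first by rewrite big_ord1 ln1 invr1 addr0.
rewrite big_ord_recr /=.
rewrite [X in _ + X <= _](_ : _ = n.+2%:R^-1) //; set v := _^-1.
set l2 := ln n.+2%:R; set l1 := ln n.+1%:R in IH.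
suff : v <= l2 - l1 by move: IH; lra.
have p1 : (0 : R) < n.+1%:R by [].
have p2 : (0 : R) < n.+2%:R by [].
(* This is ln (1 + x) <= x at x = -1/(n+2). *)
have : ln (n.+1%:R / n.+2%:R : R) <= - n.+2%:R^-1.
  have -> : (n.+1%:R / n.+2%:R : R) = 1 + - n.+2%:R^-1.
    by apply: (mulIf (lt0r_neq0 p2)); rewrite mulfVK ?lt0r_neq0 // mulrDl mulNr
      mulVf ?lt0r_neq0 // mul1r -[n.+2%:R]natr1 addrK.
  by apply: le_ln1Dx; rewrite ltrN2 invf_lt1 // ltr1n.
by rewrite ln_div ?posrE // -/v -/l1 -/l2; lra.
Qed.

(** Partial fractions: N / (k (N - k)) = 1/k + 1/(N - k), and the second sum is the first one
    reversed. *)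
Lemma sum_inv_pair_le (n : nat) :
  \sum_(k < n.+1) (n.+2%:R / (k.+1%:R * (n.+2 - k.+1)%N%:R) : R)
  <= 2 * (1 + ln n.+2%:R).
Proof.
have -> : \sum_(k < n.+1) (n.+2%:R / (k.+1%:R * (n.+2 - k.+1)%N%:R) : R) =
    \sum_(k < n.+1) (k.+1%:R : R)^-1 + \sum_(k < n.+1) (k.+1%:R : R)^-1.
  rewrite [X in _ = _ + X](reindex_inj rev_ord_inj) /= -big_split /=.
  apply: eq_bigr => k _; have kn := ltn_ord k.
  rewrite (_ : (n.+1 - k.+1).+1 = (n.+2 - k.+1)%N); last by lia.
  have -> : n.+2%:R = k.+1%:R + (n.+2 - k.+1)%N%:R :> R.
    by rewrite -natrD; congr _%:R; lia.
  have a0 : k.+1%:R != 0 :> R by [].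
  have b0 : (n.+2 - k.+1)%N%:R != 0 :> R by rewrite pnatr_eq0; lia.
  by rewrite invfM mulrDl mulVKf // mulrCA mulfV // mulr1 addrC.
have := harmonic_sum_le_ln n.
have : ln n.+1%:R <= ln n.+2%:R :> R by rewrite ler_ln ?posrE // ler_nat.
by lra.
Qed.

End Recursion.

(** * The generator on configurations and the first time scale at fixed N *)

Section Configurations.
Variables (R : realType) (S : finType).
Implicit Types (r : S -> S -> R) (x y z : S).

(** The part of [gen] free of [d]: its jumps need an occupied target. The coefficient of [d] is
    [walk_gen], which moves the particles as independent walks. *)
Definition pair_gen r (N : nat) (F : config S N -> R) (eta : config S N) : R :=
  \sum_(x : S) \sum_(y : S | y != x)
     (eta x : nat)%:R * (eta y : nat)%:R * r x y * (F (sigma x y eta) - F eta).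

Definition walk_gen r (N : nat) (F : config S N -> R) (eta : config S N) : R :=
  \sum_(x : S) \sum_(y : S | y != x)
     (eta x : nat)%:R * r x y * (F (sigma x y eta) - F eta).

Definition total_rate r : R := \sum_(x : S) \sum_(y : S | y != x) r x y.

Lemma genE r d N (F : config S N -> R) (eta : config S N) :
  gen r d F eta = pair_gen r F eta + d * walk_gen r F eta.
Proof.
rewrite /gen /pair_gen /walk_gen mulr_sumr -big_split /=.
apply: eq_bigr => x _; rewrite mulr_sumr -big_split /=.
by apply: eq_bigr => y _; ring.
Qed.

Lemma total_rate_ge0 r : (forall x y, 0 <= r x y) -> 0 <= total_rate r.
Proof. by move=> r0; do 2 rewrite sumr_ge0 // => ? _. Qed.

Lemma walk_gen_le r N (F : config S N -> R) (eta : config S N) c :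
  (forall x y, 0 <= r x y) -> 0 <= c ->
  (forall x y, y != x -> (0 < eta x)%N -> F (sigma x y eta) - F eta <= c) ->
  walk_gen r F eta <= total_rate r * (N%:R * c).
Proof.
move=> r0 c0 H; rewrite /walk_gen /total_rate mulr_suml.
apply: ler_sum => x _; rewrite mulr_suml; apply: ler_sum => y yx.
case: (posnP (eta x)) => [->|ex].
  by rewrite !mul0r mulr_ge0 // mulr_ge0.
rewrite [_%:R * r x y]mulrC -mulrA ler_wpM2l //.
have etaN : (eta x : nat)%:R <= N%:R :> R by rewrite ler_nat -ltnS ltn_ord.
apply: (@le_trans _ _ ((eta x : nat)%:R * c)); first by rewrite ler_wpM2l // H.
by rewrite ler_wpM2r.
Qed.

Lemma walk_genN r N (F : config S N -> R) (eta : config S N) :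
  walk_gen r (fun t => - F t) eta = - walk_gen r F eta.
Proof.
rewrite /walk_gen -sumrN; apply: eq_bigr => x _; rewrite -sumrN.
by apply: eq_bigr => y _; ring.
Qed.

Lemma norm_walk_gen_le r N (F : config S N -> R) (eta : config S N) c :
  (forall x y, 0 <= r x y) -> 0 <= c ->
  (forall x y, y != x -> (0 < eta x)%N -> `|F (sigma x y eta) - F eta| <= c) ->
  `|walk_gen r F eta| <= total_rate r * (N%:R * c).
Proof.
move=> r0 c0 H; rewrite ler_norml; apply/andP; split; last first.
  apply: walk_gen_le => // x y yx ex.
  by apply: le_trans (H _ _ yx ex); apply: ler_norm.
rewrite lerNl -walk_genN; apply: walk_gen_le => // x y yx ex.
by apply: le_trans (H _ _ yx ex); rewrite opprK addrC distrC ler_norm.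
Qed.

Lemma gen_linear r d N a (F G : config S N -> R) (eta : config S N) :
  gen r d (fun t => a * F t + G t) eta = a * gen r d F eta + gen r d G eta.
Proof.
rewrite /gen mulr_sumr -big_split /=; apply: eq_bigr => x _.
rewrite mulr_sumr -big_split /=; apply: eq_bigr => y _; ring.
Qed.

Lemma gen_max_le0 r d N (F : config S N -> R) (eta : config S N) :
  (forall x y, 0 <= r x y) -> 0 <= d -> (forall t, F t <= F eta) ->
  gen r d F eta <= 0.
Proof.
move=> r0 d0 H; rewrite /gen; apply: sumr_le0 => x _; apply: sumr_le0 => y _.
by rewrite mulr_ge0_le0 ?subr_le0 // mulr_ge0 // mulr_ge0 // addr_ge0.
Qed.

Lemma xi_inj N : (0 < N)%N -> injective (@xi S N).
Proof.
move=> N0 x y /ffunP/(_ x); rewrite !ffunE eqxx.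
by case: eqP => // _ /(congr1 val) /=; case: N N0.
Qed.

Lemma xiE N x z : (xi N x z : nat) = if z == x then N else 0%N.
Proof. by rewrite ffunE; case: eqP. Qed.

Lemma xi_HN N x : xi N x \in HN S N.
Proof.
rewrite inE (bigD1 x) //= xiE eqxx big1 ?addn0 // => z zx.
by rewrite xiE (negPf zx).
Qed.

Lemma sum_EN (N : nat) (h : config S N -> R) : (0 < N)%N ->
  \sum_(eta in EN S N) h eta = \sum_x h (xi N x).
Proof.
by move=> N0; rewrite big_imset /=; [|move=> x y _ _; exact: xi_inj].
Qed.

Lemma genN r d N (F : config S N -> R) (eta : config S N) :
  gen r d (fun t => - F t) eta = - gen r d F eta.
Proof.
rewrite /gen -sumrN; apply: eq_bigr => x _; rewrite -sumrN.
by apply: eq_bigr => y _; ring.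
Qed.

(** At a maximiser outside [EN] the generator is nonpositive, yet it equals [d * F], which would be
    positive if the maximum exceeded [K]. *)
Lemma discounted_le r d N (F : config S N -> R) K :
  (forall x y, 0 <= r x y) -> 0 < d -> 0 <= K ->
  (forall eta, eta \notin EN S N -> gen r d F eta = d * F eta) ->
  (forall eta, eta \in EN S N -> F eta <= K) -> forall eta, F eta <= K.
Proof.
move=> r0 d0 K0 HF HE eta.
have [t _ ht] := @Order.TotalTheory.arg_maxP _ _ (config S N) eta xpredT F isT.
apply: le_trans (ht eta isT) _; rewrite leNgt; apply/negP => Kt.
have [tE|tE] := boolP (t \in EN S N); first by move: (HE _ tE); rewrite leNgt Kt.
have := gen_max_le0 r0 (ltW d0) (fun s => ht s isT); rewrite HF //.
by rewrite pmulr_rle0 // leNgt (le_lt_trans K0 Kt).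
Qed.

Lemma discounted_norm_le r d N (F : config S N -> R) K :
  (forall x y, 0 <= r x y) -> 0 < d -> 0 <= K ->
  (forall eta, eta \notin EN S N -> gen r d F eta = d * F eta) ->
  (forall eta, eta \in EN S N -> `|F eta| <= K) -> forall eta, `|F eta| <= K.
Proof.
move=> r0 d0 K0 HF HE eta; rewrite ler_norml lerNl; apply/andP; split.
  apply: (@discounted_le r d N (fun t => - F t) K r0 d0 K0) => t ht.
    by rewrite genN HF // mulrN.
  by apply: le_trans (HE _ ht); rewrite -normrN ler_norm.
apply: (discounted_le r0 d0 K0 HF) => t ht.
by apply: le_trans (HE _ ht); rewrite ler_norm.
Qed.

(** A Dirichlet problem with boundary [EN]. The discount [d * F] yields uniqueness by the maximum
    principle alone, with no need to know that [EN] is reached, and costs only O(d) in the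
    stationarity equation. *)
Lemma discounted_extension r d N (f : S -> R) K :
  (forall x y, 0 <= r x y) -> 0 < d -> (0 < N)%N ->
  0 <= K -> (forall x, `|f x| <= K) ->
  exists F : config S N -> R,
    [/\ forall eta, `|F eta| <= K, forall x, F (xi N x) = f x &
        forall eta, eta \notin EN S N -> gen r d F eta = d * F eta].
Proof.
move=> r0 d0 N0 K0 fK.
pose L (F : config S N -> R) eta :=
  if eta \in EN S N then F eta else gen r d F eta - d * F eta.
(* Since [xi] is injective for N > 0, the sum has one term on [EN] and none elsewhere. *)
pose g (eta : config S N) : R := \sum_(x | eta == xi N x) f x.
have [||F HF] := @injective_linear_surjective R (config S N) L _ _ g.
- by move=> a u v x; rewrite /L gen_linear; case: ifP => // _; ring.
- move=> F HF eta; apply/eqP; rewrite -normr_le0.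
  apply: (discounted_norm_le r0 d0) => // t ht.
    move: (HF t); rewrite /L (negPf ht) => /eqP.
    by rewrite subr_eq0 => /eqP.
  by move: (HF t); rewrite /L ht => ->; rewrite normr0.
have Fxi x : F (xi N x) = f x.
  have := HF (xi N x); rewrite /L imset_f // /g => ->.
  by rewrite (big_pred1 x) // => z /=; rewrite (inj_eq (xi_inj N0)) eq_sym.
have FC eta : eta \notin EN S N -> gen r d F eta = d * F eta.
  move=> he; have := HF eta; rewrite /L (negPf he) /g big_pred0.
    by move/eqP; rewrite subr_eq0 => /eqP.
  by move=> x; apply: contraNF he => /eqP ->; rewrite imset_f.
exists F; split => // eta; apply: (discounted_norm_le r0 d0) => // t.
by case/imsetP => x _ ->; rewrite Fxi.
Qed.

(** * Tubes: configurations supported on two sites *)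

Definition tube N x y (k : nat) : config S N :=
  [ffun z => if z == x then inord (N - k) else if z == y then inord k else ord0].

Lemma tubeE N x y k z : (k <= N)%N ->
  (tube N x y k z : nat) = if z == x then (N - k)%N else if z == y then k else 0%N.
Proof.
move=> kN; rewrite ffunE; case: ifP => _; first by rewrite inordK // ltnS leq_subr.
by case: ifP => // _; rewrite inordK.
Qed.

Lemma tube0 N x y : tube N x y 0 = xi N x.
Proof.
apply/ffunP => z; apply: val_inj; rewrite /= tubeE // xiE subn0.
by case: ifP => // _; case: ifP.
Qed.

Lemma tubeN N x y : x != y -> tube N x y N = xi N y.
Proof.
move=> xy; apply/ffunP => z; apply: val_inj; rewrite /= tubeE // xiE subnn.
by case: (eqVneq z x) => [->|//]; rewrite (negPf xy).
Qed.

Lemma tube_notin_EN N x y k : x != y -> (0 < k < N)%N -> tube N x y k \notin EN S N.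
Proof.
move=> xy /andP[k0 kN]; apply/negP => /imsetP[w _ /ffunP e].
have := congr1 val (e x); have := congr1 val (e y).
rewrite /= !tubeE ?xiE; try exact: ltnW.
rewrite eqxx (eq_sym y x) (negPf xy) eqxx.
by case: eqP => [<-|_]; rewrite ?(negPf xy); lia.
Qed.

Lemma tube_fst N x y k : (k <= N)%N -> (tube N x y k x : nat) = (N - k)%N.
Proof. by move=> kN; rewrite tubeE // eqxx. Qed.

Lemma tube_snd N x y k : x != y -> (k <= N)%N -> (tube N x y k y : nat) = k.
Proof. by move=> xy kN; rewrite tubeE // eq_sym (negPf xy) eqxx. Qed.

Lemma sigma_tube N x y k : x != y -> (k < N)%N ->
  sigma x y (tube N x y k) = tube N x y k.+1.
Proof.
move=> xy kN; have kN' := ltnW kN.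
rewrite /sigma xy tube_fst // tube_snd // subn_gt0 kN /=.
apply/ffunP => z; apply: val_inj; rewrite /= [RHS]tubeE // ffunE.
have [_|zx] := eqVneq z x; first by rewrite inordK; lia.
have [_|zy] := eqVneq z y; first by rewrite inordK //; lia.
by rewrite tubeE // (negPf zx) (negPf zy).
Qed.

Lemma sigma_tube_back N x y k : x != y -> (0 < k <= N)%N ->
  sigma y x (tube N x y k) = tube N x y k.-1.
Proof.
move=> xy /andP[k0 kN]; have kN' : (k.-1 <= N)%N by lia.
have yx : y != x by rewrite eq_sym.
rewrite /sigma yx tube_fst // tube_snd // k0 /=.
apply/ffunP => z; apply: val_inj; rewrite /= [RHS]tubeE // ffunE.
have [->|zy] := eqVneq z y; first by rewrite (negPf yx) inordK //; lia.
have [_|zx] := eqVneq z x; first by rewrite inordK //; lia.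
by rewrite tubeE // (negPf zx) (negPf zy).
Qed.

(** Only [x] and [y] are occupied, so the jumps between them are the only ones with an occupied
    source and target. *)
Lemma pair_gen_tube r N (F : config S N -> R) x y k : x != y -> (0 < k < N)%N ->
  pair_gen r F (tube N x y k) =
  k%:R * (N - k)%:R *
   (r x y * (F (tube N x y k.+1) - F (tube N x y k))
    - r y x * (F (tube N x y k) - F (tube N x y k.-1))).
Proof.
move=> xy /andP[k0 kN]; have kN' := ltnW kN; have yx : y != x by rewrite eq_sym.
have out z : z != x -> z != y -> (tube N x y k z : nat) = 0%N.
  by move=> zx zy; rewrite tubeE // (negPf zx) (negPf zy).
rewrite /pair_gen (bigD1 x) //= [X in _ + X](bigD1 y) //= [X in _ + (_ + X)]big1; last first.
  move=> z /andP[zx zy]; rewrite out //.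
  by apply: big1 => w _; rewrite !mul0r.
rewrite [X in X + _](bigD1 y) //= [X in _ + X + _]big1; last first.
  by move=> z /andP[zx zy]; rewrite (out z) // mulr0n mulr0 !mul0r.
rewrite [X in _ + (X + _)](bigD1 x) //= [X in _ + (_ + X + _)]big1; last first.
  by move=> z /andP[zx zy]; rewrite (out z) // mulr0n mulr0 !mul0r.
rewrite tube_fst // tube_snd // sigma_tube // sigma_tube_back ?k0 //.
by ring.
Qed.

(** Every target is empty, so each jump rate carries the factor [d]; this makes N d the rate of the
    first time scale. *)
Lemma gen_xi r d N (F : config S N -> R) x : (0 < N)%N ->
  gen r d F (xi N x) =
  N%:R * d * \sum_(y | y != x) r x y * (F (tube N x y 1) - F (xi N x)).
Proof.
move=> N0; rewrite /gen (bigD1 x) //= [X in _ + X]big1 ?addr0; last first.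
  by move=> z zx; apply: big1 => w _; rewrite xiE (negPf zx) !mul0r.
rewrite mulr_sumr; apply: eq_bigr => y yx.
rewrite !xiE eqxx (negPf yx) addr0 -(tube0 N x y) sigma_tube //; last by rewrite eq_sym.
by rewrite mulrA.
Qed.

(* A tube of two sites is left at rate O(d N), while at position k it is
   traversed at rate k (N - k); summed over k this is an error O(d ln N). *)
Lemma tube_estimate r d n (F : config S n.+2 -> R) K x y : x != y ->
  (forall x y, 0 <= r x y) -> 0 < d -> (forall eta, `|F eta| <= K) ->
  (forall eta, eta \notin EN S n.+2 -> gen r d F eta = d * F eta) ->
  `|r x y * (F (tube n.+2 x y 1) - F (xi n.+2 x))
    - brate r x y * (F (xi n.+2 y) - F (xi n.+2 x))|
  <= (r x y + r y x) * (2 * K) / n.+2%:R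
     + 4 * K * (1 + 2 * total_rate r) * (d * (1 + ln n.+2%:R)).
Proof.
move=> xy r0 d0 FK HF; set N := n.+2 in F FK HF *.
have K0 : 0 <= K by apply: le_trans (FK (xi N x)).
have Rt0 := total_rate_ge0 r0.
have dF s t : `|F s - F t| <= 2 * K.
  by apply: le_trans (ler_normB _ _) _; have := FK s; have := FK t; lra.
(* Along the tube, k (N - k) times the increment difference equals d (F - [walk_gen] F); there |F|
   <= K N and the walk part is at most 2 K N times the total rate, whence d N c. *)
set c := K * (1 + 2 * total_rate r).
have c0 : 0 <= c by rewrite /c mulr_ge0 // addr_ge0 // mulr_ge0.
pose e k : R := d * c * (N%:R / (k.+1%:R * (N - k.+1)%N%:R)).
have e0 k : 0 <= e k 
  by rewrite /e; apply: mulr_ge0; [rewrite mulr_ge0 // ltW|rewrite divr_ge0 ?mulr_ge0].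
have He k : (k < n.+1)%N ->
   `|r x y * (F (tube N x y k.+2) - F (tube N x y k.+1))
     - r y x * (F (tube N x y k.+1) - F (tube N x y k))| <= e k.
  move=> kn; have kN : (0 < k.+1 < N)%N by rewrite /N.
  have := HF _ (tube_notin_EN xy kN); rewrite genE pair_gen_tube //=.
  set D := r x y * _ - _ => hD.
  have P : 0 < k.+1%:R * (N - k.+1)%N%:R :> R by rewrite mulr_gt0 // ltr0n subn_gt0.
  rewrite /e mulrA ler_pdivlMr // mulrC -{1}(gtr0_norm P) -normrM.
  have -> : k.+1%:R * (N - k.+1)%N%:R * D =
      d * (F (tube N x y k.+1) - walk_gen r F (tube N x y k.+1)).
    by rewrite [RHS]mulrBr -hD addrK.
  rewrite normrM gtr0_norm // -mulrA ler_pM2l //.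
  apply: le_trans (ler_normB _ _) _.
  have K2 : 0 <= 2 * K by rewrite mulr_ge0.
  have := norm_walk_gen_le r0 K2 (fun x' y' _ _ => dF (sigma x' y' (tube N x y k.+1)) _).
  have := FK (tube N x y k.+1).
  have : K <= K * N%:R by rewrite ler_peMr // ler1n.
  by rewrite /c; lra.
have := first_increment_estimate (r0 x y) (r0 y x) e0 He.
rewrite tube0 tubeN // -/(brate r x y) => h; apply: le_trans h _; apply: lerD.
  rewrite ler_wpM2r ?invr_ge0 // ler_wpM2l ?dF //.
  by rewrite addr_ge0.
rewrite /e -mulr_sumr.
have := sum_inv_pair_le R n; rewrite -/N; set s := \sum_(k < n.+1) _ => hs.
have dc : 0 <= d * c by rewrite mulr_ge0 // ltW.
have := ler_wpM2l dc hs; rewrite /c; lra.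
Qed.

Lemma invariant_prob_le1 r d N (mu : config S N -> R) :
  invariant_prob r d mu -> forall eta, mu eta <= 1.
Proof.
case=> mu0 _ mu1 _ eta; rewrite -mu1 (bigD1 eta) //= lerDl.
by rewrite sumr_ge0.
Qed.

(** Stationarity is tested on the discounted extension of [f]: the condensed configurations
    contribute N d J, all others at most d K, so J is O(1/N). [tube_estimate] then replaces the
    first tube increments in J by [brate] terms. Taking N = n + 2 leaves every tube an interior. *)
Lemma condensate_rate_estimate r (f : S -> R) : (forall x y, 0 <= r x y) ->
  exists2 C, 0 <= C & forall n d (mu : config S n.+2 -> R),
    0 < d -> invariant_prob r d mu ->
  `|\sum_x mu (xi n.+2 x) * \sum_(y | y != x) brate r x y * (f y - f x)|
  <= C * (n.+2%:R^-1 + d * (1 + ln n.+2%:R)).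
Proof.
move=> r0; pose K := \sum_x `|f x|.
have K0 : 0 <= K by rewrite sumr_ge0.
have fK x : `|f x| <= K by rewrite /K (bigD1 x) //= lerDl sumr_ge0.
have Rt0 := total_rate_ge0 r0.
pose C1 x y := (r x y + r y x) * (2 * K).
pose C2 := 4 * K * (1 + 2 * total_rate r).
have C10 x y : 0 <= C1 x y by rewrite /C1 mulr_ge0 ?addr_ge0 ?mulr_ge0.
have C20 : 0 <= C2 by rewrite /C2 !mulr_ge0 ?addr_ge0 ?mulr_ge0.
(* [K] pays for J, and [C1 x y + C2] for the tube from [x] to [y]. *)
pose C := K + \sum_x \sum_(y | y != x) (C1 x y + C2).
exists C.
  rewrite addr_ge0 //; apply: sumr_ge0 => x _; apply: sumr_ge0 => y _.
  exact: addr_ge0.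
move=> n d mu d0 inv; have mu1 := invariant_prob_le1 inv.
have [mu0 muH muS muG] := inv; set N := n.+2 in mu inv mu1 mu0 muH muS muG *.
have [F [FK Fxi HF]] := @discounted_extension r d N f K r0 d0 isT K0 fK.
have N0 : 0 < N%:R :> R by [].
set l := d * _; set v := _^-1.
have l0 : 0 <= l by rewrite /l (mulr_ge0 (ltW d0)) // addr_ge0 // ln_ge0 // ler1n.
have v0 : 0 <= v by rewrite invr_ge0.
pose J := \sum_x mu (xi N x) *
   \sum_(y | y != x) r x y * (F (tube N x y 1) - F (xi N x)).
have HJ : `|J| <= K * v.
  have := muG F; rewrite (bigID (fun eta => eta \in EN S N)) /=.
  rewrite (eq_bigl (fun eta => eta \in EN S N)); last first.
    move=> eta; apply: andb_idl => /imsetP[x _ ->]; exact: xi_HN.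
  rewrite sum_EN //= (_ : \sum_x _ = N%:R * d * J); last first.
    by rewrite mulr_sumr; apply: eq_bigr => x _; rewrite gen_xi // mulrCA.
  under eq_bigr => eta /andP[_ he] do rewrite HF // mulrCA.
  rewrite -mulr_sumr; set T := \sum_(_ | _) _ => hT.
  have T1 : `|T| <= K.
    apply: le_trans (ler_norm_sum _ _ _) _.
    rewrite -[K]mul1r -muS mulr_suml big_mkcond /=; apply: ler_sum => eta _.
    case: ifP => _; last by rewrite mulr_ge0.
    by rewrite normrM ger0_norm // ler_wpM2l.
  have -> : J = - T * v.
    have : N%:R * J = - T.
      apply: (mulfI (lt0r_neq0 d0)); rewrite mulrA [d * _]mulrC mulrN.
      by apply/eqP; rewrite -addr_eq0 hT.
    by move=> <-; rewrite mulrAC /v mulfV ?mul1r ?lt0r_neq0.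
  by rewrite normrM normrN (ger0_norm v0) ler_wpM2r.
set I := \sum_x _.
have HIJ : `|J - I| <= \sum_x \sum_(y | y != x) (C1 x y + C2) * (v + l).
  rewrite -sumrB; apply: le_trans (ler_norm_sum _ _ _) _.
  apply: ler_sum => x _; rewrite -mulrBr -sumrB normrM ger0_norm //.
  apply: le_trans (_ : 1 * _ <= _); first by apply: ler_wpM2r.
  rewrite mul1r; apply: le_trans (ler_norm_sum _ _ _) _.
  apply: ler_sum => y yx; rewrite -(Fxi x) -(Fxi y).
  have xy : x != y by rewrite eq_sym.
  apply: le_trans (tube_estimate xy r0 d0 FK HF) _.
  rewrite -/(C1 x y) -/C2 -/l -/v.
  have := mulr_ge0 (C10 x y) l0; have := mulr_ge0 C20 v0; lra.
have -> : I = J - (J - I) by ring.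
apply: le_trans (ler_normB _ _) _.
have -> : C * (v + l) =
    K * v + K * l + \sum_x \sum_(y | y != x) (C1 x y + C2) * (v + l).
  rewrite /C mulrDl [K * _]mulrDr; congr (_ + _).
  by rewrite mulr_suml; apply: eq_bigr => x _; rewrite mulr_suml.
by have := mulr_ge0 K0 l0; lra.
Qed.

End Configurations.

(** * Limits of real sequences *)

Section Limits.
Variable R : realType.

Lemma cvg_sum_seq (I : finType) (P : pred I) (u : nat -> I -> R) (l : I -> R) :
  (forall i, P i -> u ^~ i @ \oo --> l i) ->
  (fun N => \sum_(i | P i) u N i) @ \oo --> \sum_(i | P i) l i.
Proof.
move=> H; elim: (index_enum I) => [|i s IH].
  rewrite big_nil; under eq_fun do rewrite big_nil; exact: cvg_cst.
rewrite big_cons; under eq_fun do rewrite big_cons.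
case: ifP => // Pi; exact: cvgD (H _ Pi) IH.
Qed.

Lemma eq_seq_cvg (u v : nat -> R) (l : R) :
  v @ \oo --> l -> (forall N, u N = v N) -> u @ \oo --> l.
Proof. by move=> vl /funext ->. Qed.

Lemma norm_le_cvg0 (k : nat) (u v : nat -> R) :
  (forall N, (k <= N)%N -> `|u N| <= v N) -> v @ \oo --> (0 : R) ->
  u @ \oo --> (0 : R).
Proof.
move=> uv v0; apply: (@squeeze_cvgr _ _ _ _ (- v) v) => //; last first.
  by rewrite -oppr0; apply: cvgN.
by exists k => // N /= kN; rewrite -ler_norml uv.
Qed.

Lemma cvg_inv_nat : (fun N : nat => (N%:R : R)^-1) @ \oo --> (0 : R).
Proof.
apply/(@gtr0_cvgV0 _ _ _ _ (fun N : nat => N%:R : R)); last exact: cvgr_idn.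
by exists 1%N => // N /= N1; rewrite ltr0n.
Qed.

End Limits.

(** * Finite chains: maximum principle, Poisson equation and identification of the limit *)

Section LimitChain.
Variables (R : realType) (S : finType).
Implicit Types (q : S -> S -> R) (A : {set S}) (f : S -> R).

(** Jumps out of [A] are suppressed, as in the balance equations of [invariant_prob_on]. *)
Definition chain_gen q A f (x : S) : R :=
  \sum_(z in A | z != x) q x z * (f z - f x).

Lemma chain_gen_linear q A a f g x :
  chain_gen q A (fun t => a * f t + g t) x = a * chain_gen q A f x + chain_gen q A g x.
Proof.
by rewrite /chain_gen mulr_sumr -big_split /=; apply: eq_bigr => z _; ring.
Qed.

Lemma chain_genN q A f x :
  chain_gen q A (fun t => - f t) x = - chain_gen q A f x.
Proof. by rewrite /chain_gen -sumrN; apply: eq_bigr => z _; ring. Qed.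

Lemma chain_gen_max_le0 q A f x : (forall x y, 0 <= q x y) ->
  (forall z, z \in A -> f z <= f x) -> chain_gen q A f x <= 0.
Proof.
move=> q0 H; apply: sumr_le0 => z /andP[zA _].
by rewrite mulr_ge0_le0 // subr_le0 H.
Qed.

Lemma chain_gen_max_eq q A f x z : (forall x y, 0 <= q x y) ->
  (forall z, z \in A -> f z <= f x) -> 0 <= chain_gen q A f x ->
  z \in A -> posrel q x z -> f z = f x.
Proof.
move=> q0 H g0 zA /andP[xz qxz]; apply/eqP; rewrite eq_le H //= leNgt; apply/negP => lt.
move: g0; rewrite /chain_gen (bigD1 z) /=; last by rewrite zA eq_sym.
have : q x z * (f z - f x) < 0 by rewrite pmulr_rlt0 // subr_lt0.
have : \sum_(i | (i \in A) && (i != x) && (i != z)) q x i * (f i - f x) <= 0.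
  apply: sumr_le0 => w /andP[/andP[wA _] _].
  by rewrite mulr_ge0_le0 // subr_le0 H.
by lra.
Qed.

(** Maximality passes from each vertex of the path to the next by [chain_gen_max_eq]. The target [y]
    is exempt from the sign condition because the walk stops there. *)
Lemma chain_gen_max_connect q A f x y : (forall x y, 0 <= q x y) ->
  (forall z, z \in A -> f z <= f x) ->
  (forall z, z \in A -> f z = f x -> z != y -> 0 <= chain_gen q A f z) ->
  x \in A -> connect [rel u v | [&& u \in A, v \in A & posrel q u v]] x y ->
  f y = f x.
Proof.
move=> q0 H Hg xA /connectP[p].
set e := [rel u v | _].
suff: forall z, z \in A -> f z = f x -> path e z p -> y = last z p -> f y = f x.
  exact.
elim: p => [|w p IH] z zA fz /=; first by move=> _ ->.
move=> /andP[/and3P[_ wA zw] pp] ey.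
have [zy|zy] := eqVneq z y; first by rewrite -zy.
have Hz t : t \in A -> f t <= f z by rewrite fz; exact: H.
apply: (IH w wA _ pp ey).
by rewrite (chain_gen_max_eq q0 Hz (Hg _ zA fz zy) wA zw).
Qed.

Lemma subharmonic_le q A f x0 x : (forall x y, 0 <= q x y) -> irreducible_on q A ->
  (forall z, z \in A -> 0 <= chain_gen q A f z) -> x0 \in A -> x \in A -> f x <= f x0.
Proof.
move=> q0 irr Hg x0A xA.
have [t tA ht] := @Order.TotalTheory.arg_maxP _ _ S x0 (mem A) f x0A.
rewrite (@chain_gen_max_connect q A f t x0) //; first exact: ht.
  by move=> z zA _ _; exact: Hg.
exact: irr.
Qed.

(** In the kernel of [L], the generator is constantly [- f x0] on [A]. A maximiser gives [f x0 >= 0]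
    and the same argument for [-f] the reverse, so [f] is harmonic on [A], hence constant, hence
    0. *)
Lemma poisson_equation q A x0 (g : S -> R) :
  (forall x y, 0 <= q x y) -> irreducible_on q A -> x0 \in A ->
  exists f c, forall z, z \in A -> chain_gen q A f z = g z - c.
Proof.
move=> q0 irr x0A.
(* Adding [f x0] removes the constants from the kernel; its value is c. *)
pose L f x := if x \in A then chain_gen q A f x + f x0 else f x.
have [||f Hf] := @injective_linear_surjective R S L _ _ g.
- by move=> a u v x; rewrite /L chain_gen_linear; case: ifP => // _; ring.
- move=> f Hf.
  have HA z : z \in A -> chain_gen q A f z = - f x0.
    by move=> zA; have := Hf z; rewrite /L zA => /eqP; rewrite addr_eq0 => /eqP.
  have ge h : (forall z, z \in A -> chain_gen q A h z = - h x0) -> 0 <= h x0.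
    move=> hA; have [t tA ht] := @Order.TotalTheory.arg_maxP _ _ S x0 (mem A) h x0A.
    by have := chain_gen_max_le0 q0 ht; rewrite hA // oppr_le0.
  have f0 : f x0 = 0.
    apply/eqP; rewrite eq_le ge // andbT -oppr_ge0.
    by apply: (ge (fun t => - f t)) => z zA; rewrite chain_genN HA.
  move=> x; have [xA|xA] := boolP (x \in A); last first.
    by have := Hf x; rewrite /L (negPf xA).
  apply/eqP; rewrite eq_le; apply/andP; split.
    rewrite -f0; apply: (subharmonic_le q0 irr) => // z zA.
    by rewrite HA // f0 oppr0.
  rewrite -oppr_le0 -[X in _ <= X]oppr0 -f0.
  apply: (@subharmonic_le q A (fun t => - f t)) => // z zA.
  by rewrite chain_genN HA // f0 oppr0 oppr0.
exists f, (f x0) => z zA; rewrite -Hf /L zA; ring.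
Qed.

Lemma invariant_prob_on_chain_gen q A nu f :
  invariant_prob_on q A nu -> \sum_(x in A) nu x * chain_gen q A f x = 0.
Proof.
case=> _ _ _ H.
have e1 : \sum_(x in A) nu x * chain_gen q A f x =
    \sum_(x in A) \sum_(z in A | z != x) nu x * q x z * f z
    - \sum_(x in A) \sum_(z in A | z != x) nu x * q x z * f x.
  rewrite -sumrB; apply: eq_bigr => x _; rewrite /chain_gen mulr_sumr -sumrB.
  by apply: eq_bigr => z _; ring.
rewrite e1 (exchange_big_dep (mem A)) /=; last by move=> x z _ /andP[].
apply/eqP; rewrite subr_eq0; apply/eqP; apply: eq_bigr => y yA.
rewrite (eq_bigl (fun i => (i \in A) && (i != y))); last first.
  by move=> x; rewrite yA eq_sym.
rewrite -mulr_suml H // mulr_sumr mulr_suml.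
by [].
Qed.

(** The indicator of [y] as test function gives the balance equation at [y]. *)
Lemma chain_gen_invariant_prob_on q A nu :
  (forall x, 0 <= nu x) -> (forall x, x \notin A -> nu x = 0) ->
  \sum_x nu x = 1 ->
  (forall f, \sum_(x in A) nu x * chain_gen q A f x = 0) ->
  invariant_prob_on q A nu.
Proof.
move=> nu0 nuA nu1 H; split => // y yA.
have := H (fun x => (x == y)%:R); rewrite (bigD1 y) //= {1}/chain_gen.
rewrite (eq_bigr (fun z => - q y z)); last first.
  by move=> z /andP[_ zy]; rewrite (negPf zy) eqxx sub0r mulrN1.
rewrite sumrN mulrN => /eqP; rewrite addrC subr_eq0 => /eqP <-.
apply: eq_bigr => x /andP[xA xy]; congr (_ * _).
rewrite /chain_gen (bigD1 y) /=; last by rewrite yA eq_sym.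
rewrite eqxx (negPf xy) subr0 mulr1 big1 ?addr0 // => z /andP[_ zy].
by rewrite (negPf zy) subrr mulr0.
Qed.

(** A zero of [nu] has zero inflow, so [nu] vanishes at all its predecessors; by irreducibility it
    would then vanish everywhere, against total mass 1. *)
Lemma invariant_prob_on_gt0 q A nu x : (forall x y, 0 <= q x y) ->
  irreducible_on q A -> invariant_prob_on q A nu -> x \in A -> 0 < nu x.
Proof.
move=> q0 irr [nu0 nuA nu1 H] xA; rewrite lt_neqAle nu0 andbT eq_sym.
apply/eqP => nux; suff z0 y : nu y = 0.
  by move: nu1; rewrite big1 // => /esym/eqP; rewrite oner_eq0.
have [yA|/nuA //] := boolP (y \in A).
have /connectP[p] := irr _ _ yA xA.
elim: p y yA => [|w p IH] y yA /=; first by move=> _ <-.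
move=> /andP[/and3P[_ wA /andP[yw qyw]] pp] e.
have nuw := IH w wA pp e.
have := H w wA; rewrite nuw mul0r => /eqP; rewrite psumr_eq0; last first.
  by move=> i _; rewrite mulr_ge0.
move=> /allP/(_ y (mem_index_enum _)); rewrite yA yw /= mulf_eq0.
by rewrite (gt_eqF qyw) orbF => /eqP.
Qed.

Lemma in_Sstar_cvg (mu : forall N, config S N -> R) x l :
  (fun N => mu N (xi N x)) @ \oo --> l -> in_Sstar mu x <-> 0 < l.
Proof.
move=> cl; split.
  case=> e e0 He; rewrite ltNge; apply/negP => l0.
  have [M _ HM] : \forall N \near \oo, mu N (xi N x) < e.
    by apply: (cvgr_lt _ cl); exact: le_lt_trans l0 e0.
  have [N MN] := He M; have := HM N MN; move=> /= h1 h2.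
  by move: (lt_trans h1 h2); rewrite ltxx.
move=> l0; exists (l / 2); first by rewrite divr_gt0.
have [M _ HM] : \forall N \near \oo, l / 2 < mu N (xi N x).
  by apply: (cvgr_gt _ cl); lra.
move=> M'; exists (maxn M M'); first exact: leq_maxr.
by apply: HM; exact: leq_maxl.
Qed.

(** The Poisson constants [c x] serve three times: as the limits of the masses, as the existing
    invariant probability, and, by testing any other invariant probability on the same solutions,
    for uniqueness. *)
Lemma limit_chain q A (mu : forall N, config S N -> R) :
  (forall x y, 0 <= q x y) -> irreducible_on q A ->
  (forall N x, 0 <= mu N (xi N x)) ->
  (forall x, x \notin A -> (fun N => mu N (xi N x)) @ \oo --> (0 : R)) ->
  (fun N => \sum_(x in A) mu N (xi N x)) @ \oo --> (1 : R) ->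
  (forall f, (fun N => \sum_(x in A) mu N (xi N x) * chain_gen q A f x)
      @ \oo --> (0 : R)) ->
  conclusion mu A q.
Proof.
move=> q0 irr mu0 muA mu1 Hf.
(* If [A] were empty its mass would be 0 for all N; a point of [A] is needed to normalise the
   Poisson equation. *)
have [x0 x0A] : exists x0, x0 \in A.
  have [A0|[x xA]] := set_0Vmem A; last by exists x.
  move: mu1; rewrite A0; under eq_fun do rewrite big_set0; move=> c1.
  have e10 : 1 = 0 :> R by apply: (norm_cvg_unique c1); exact: cvg_cst.
  by move/eqP: e10; rewrite oner_eq0.
have /choice[c Hc] : forall x, exists c, x \in A ->
    (exists f, forall z, z \in A -> chain_gen q A f z = (z == x)%:R - c).
  move=> x; have [f [c H]] := poisson_equation (fun z => (z == x)%:R) q0 irr x0A.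
  by exists c => _; exists f.
pose nu x := if x \in A then c x else 0.
have sum_delta (m : S -> R) x : x \in A ->
    \sum_(z in A) m z * ((z == x)%:R - c x) = m x - c x * \sum_(z in A) m z.
  move=> xA; under eq_bigr => z _ do rewrite mulrBr.
  rewrite sumrB -mulr_suml [c x * _]mulrC; congr (_ - _).
  rewrite (bigD1 x) //= eqxx mulr1 big1 ?addr0 // => z /andP[_ zx].
  by rewrite (negPf zx) mulr0.
have cnu x : (fun N => mu N (xi N x)) @ \oo --> nu x.
  have [xA|xA] := boolP (x \in A); last by rewrite /nu (negPf xA); exact: muA.
  have [f ef] := Hc x xA; have := Hf f.
  have -> : (fun N => \sum_(z in A) mu N (xi N z) * chain_gen q A f z) =
      (fun N => mu N (xi N x) - c x * \sum_(z in A) mu N (xi N z)).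
    apply: funext => N; rewrite -(sum_delta (fun z => mu N (xi N z)) x xA).
    by apply: eq_bigr => z zA; rewrite ef.
  move=> h; rewrite /nu xA -[c x]add0r -[c x]mulr1.
  apply: (@eq_seq_cvg _ _ (fun N => (mu N (xi N x) - c x * \sum_(z in A) mu N (xi N z))
    + c x * \sum_(z in A) mu N (xi N z))) => [|N]; last by rewrite subrK.
  by apply: cvgD h _; apply: cvgM mu1; exact: cvg_cst.
have nuP : invariant_prob_on q A nu.
  apply: chain_gen_invariant_prob_on.
  - move=> x; apply: (ler_cvg_to (cvg_cst 0) (cnu x)).
    by apply: nearW => N; exact: mu0.
  - by move=> x xA; rewrite /nu (negPf xA).
  - rewrite (bigID (mem A)) /= [X in _ + X]big1 ?addr0; last first.
      by move=> x xA; rewrite /nu (negPf xA).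
    apply: (norm_cvg_unique _ mu1).
    by apply: cvg_sum_seq => x _; exact: cnu.
  - move=> f; apply: (norm_cvg_unique _ (Hf f)).
    apply: cvg_sum_seq => x _; apply: cvgM (cnu x) _; exact: cvg_cst.
split; last split.
- move=> x; rewrite (in_Sstar_cvg (cnu x)); split => [|xA].
    by rewrite /nu; case: ifP => //; rewrite ltxx.
  exact: (invariant_prob_on_gt0 q0 irr nuP xA).
- by exists nu.
- move=> nu' nuP' x xA; suff -> : nu' x = nu x by exact: cnu.
  rewrite /nu xA; have [f ef] := Hc x xA.
  have := invariant_prob_on_chain_gen f nuP'.
  under eq_bigr => z zA do rewrite ef //.
  rewrite sum_delta //; have [_ nuA' nu1' _] := nuP'.
  move: nu1'; rewrite (bigID (mem A)) /= [X in _ + X]big1 // addr0 => ->.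
  by rewrite mulr1 => /eqP; rewrite subr_eq0 => /eqP.
Qed.

End LimitChain.

(** * Recurrent and transient states of the chain with rates b *)

Section RecurrentStates.
Variables (R : realType) (S : finType) (r : S -> S -> R).

Lemma brate_ge0 x y : 0 <= brate r x y.
Proof. by rewrite /brate; case: ltP => // h; rewrite subr_ge0 ltW. Qed.

Lemma posrel_brate x y : y != x -> brate r x y != 0 -> posrel (brate r) x y.
Proof.
move=> yx b0; apply/andP; split; first by rewrite eq_sym.
by rewrite lt_neqAle eq_sym b0 brate_ge0.
Qed.

Lemma recurrent_set_closed (q : S -> S -> R) x y :
  x \in recurrent_set q -> posrel q x y -> y \in recurrent_set q.
Proof.
rewrite !inE => /forallP Hx xy; apply/forallP => z; apply/implyP => yz.
have xz := connect_trans (connect1 xy) yz.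
by apply: connect_trans (connect1 xy); have := Hx z; rewrite xz.
Qed.

(** Among the states reachable from [x], take one whose own reachable set is smallest: whatever it
    leads to reaches an equally large subset, hence the same set, and so leads back. *)
Lemma connect_recurrent_set (q : S -> S -> R) x :
  exists2 y, y \in recurrent_set q & connect (posrel q) x y.
Proof.
have [y xy ymin] := @arg_minnP S x (connect (posrel q) x)
  (fun y => #|connect (posrel q) y|) (connect0 _ x).
exists y => //; rewrite inE; apply/forallP => z; apply/implyP => yz.
have sub : connect (posrel q) z \subset connect (posrel q) y.
  by apply/fintype.subsetP => w; exact: connect_trans yz.
have := ymin z (connect_trans xy yz) => le.
have card_eq : #|connect (posrel q) z| = #|connect (posrel q) y|.
  by apply/eqP; rewrite eqn_leq le andbT subset_leq_card.
have : y \in connect (posrel q) z.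
  by rewrite (subset_cardP card_eq sub); exact: connect0.
exact.
Qed.

(** The function is the mean time to reach S_0: it is 0 on S_0 and solves the equation with right
    side -1 elsewhere. Uniqueness follows by carrying a maximum along a path into S_0; on S_0 itself
    the equation holds because S_0 is closed. *)
Lemma transient_test_function :
  exists f : S -> R, forall x,
    chain_gen (brate r) [set: S] f x = - (x \notin Szero r)%:R.
Proof.
pose B f x := chain_gen (brate r) [set: S] f x.
pose L f x := if x \in Szero r then f x else B f x.
have [||f Hf] := @injective_linear_surjective R S L _ _ (fun x => - (x \notin Szero r)%:R).
- by move=> a u v x; rewrite /L /B chain_gen_linear; case: ifP.
- have le f : (forall x, L f x = 0) -> forall x, f x <= 0.
    move=> Hf x.
    have [t _ ht] := @Order.TotalTheory.arg_maxP _ _ S x xpredT f isT.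
    apply: le_trans (ht x isT) _.
    have [y y0 ty] := connect_recurrent_set (brate r) t.
    have fy z : z \in Szero r -> f z = 0 by move=> z0; have := Hf z; rewrite /L z0.
    rewrite -(fy y y0).
    have {ty} : connect [rel u v | [&& u \in [set: S], v \in [set: S]
        & posrel (brate r) u v]] t y.
      by rewrite (eq_connect (e' := posrel (brate r))) // => u v /=; rewrite !in_setT.
    case/connectP => p pp ey.
    elim: p t ht pp ey => [|w p IH] t ht /=; first by move=> _ ->.
    move=> /andP[/and3P[_ _ tw] pp] ey.
    have [t0|t0] := boolP (t \in Szero r); first by rewrite (fy t t0) fy.
    have fw : f w = f t.
      apply: (@chain_gen_max_eq _ _ (brate r) [set: S]) tw => //.
      - exact: brate_ge0.
      - by move=> z _; exact: ht.
      - by have := Hf t; rewrite /L (negPf t0) /B => ->.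
    rewrite -fw; apply: IH => // z _; rewrite fw; exact: ht.
  move=> f Hf x; apply/eqP; rewrite eq_le le //= -oppr_le0.
  apply: (le (fun t => - f t)) => z; have := Hf z; rewrite /L /B chain_genN.
  by case: ifP => _ ->; rewrite oppr0.
exists f => x; have := Hf x; rewrite /L; case: ifP => // x0 _.
have f0 z : z \in Szero r -> f z = 0.
  by move=> z0; have := Hf z; rewrite /L z0 /= oppr0.
rewrite oppr0; apply: big1 => z /andP[_ zx].
have [/eqP ->|bz] := boolP (brate r x z == 0); first by rewrite mul0r.
rewrite (f0 x) // (f0 z) ?subrr ?mulr0 //.
exact: recurrent_set_closed x0 (posrel_brate zx bz).
Qed.

End RecurrentStates.

(** * The limit on the first time scale; part (a) *)

Section FirstTimeScale.
Variables (R : realType) (S : finType) (r : S -> S -> R) (d : nat -> R).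
Variable mu : forall N, config S N -> R.
Arguments mu : clear implicits.
Hypothesis r0 : forall x y, 0 <= r x y.
Hypothesis d_gt0 : forall N, 0 < d N.
Hypothesis cvg_d : d @ \oo --> (0 : R).
Hypothesis cvg_dln : (fun N => d N * ln N%:R) @ \oo --> (0 : R).
Hypothesis mu_inv : forall N, invariant_prob r (d N) (mu N).
Hypothesis condensation : (fun N => \sum_(eta in EN S N) mu N eta) @ \oo --> (1 : R).

Lemma mu_xi_ge0 N x : 0 <= mu N (xi N x).
Proof. by have [h _ _ _] := mu_inv N; exact: h. Qed.

Lemma cvg_sum_xi : (fun N => \sum_x mu N (xi N x)) @ \oo --> (1 : R).
Proof.
apply: cvg_trans condensation; apply: near_eq_cvg.
by exists 1%N => // N /= N1; rewrite sum_EN.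
Qed.

Lemma cvg_brate_gen (f : S -> R) :
  (fun N => \sum_x mu N (xi N x) * chain_gen (brate r) [set: S] f x)
    @ \oo --> (0 : R).
Proof.
have [C C0 HC] := condensate_rate_estimate f r0.
(* The bound starts at N = 2 because the estimate is stated for n + 2 particles. *)
apply: (@norm_le_cvg0 _ 2 _ (fun N => C * (N%:R^-1 + (d N + d N * ln N%:R)))).
  case=> [|[|n]] // _; have := HC n (d n.+2) (mu n.+2) (d_gt0 _) (mu_inv _).
  rewrite -[X in _ <= _ * (_ + (X + _))]mulr1 -mulrDr => h; apply: le_trans h.
  rewrite le_eqVlt; apply/orP; left; apply/eqP; congr (`| _ |).
  apply: eq_bigr => x _; congr (_ * _); apply: eq_bigl => y.
  by rewrite inE.
rewrite [X in _ --> X](_ : 0 = C * (0 + (0 + 0))); last by rewrite !addr0 mulr0.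
apply: cvgM; first exact: cvg_cst.
apply: cvgD; first exact: cvg_inv_nat.
exact: cvgD.
Qed.

(** For the test function above, the vanishing quantity is minus the total mass of the transient
    condensates, so it dominates each of them. *)
Lemma cvg_transient x : x \notin Szero r -> (fun N => mu N (xi N x)) @ \oo --> (0 : R).
Proof.
move=> x0; have [f Hf] := transient_test_function r.
apply: (@norm_le_cvg0 _ 0 _
  (fun N => - \sum_x mu N (xi N x) * chain_gen (brate r) [set: S] f x)).
  move=> N _; rewrite -sumrN ger0_norm ?mu_xi_ge0 // (bigD1 x) //=.
  rewrite Hf x0 mulrN1 opprK lerDl sumr_ge0 // => z _.
  by rewrite Hf mulrN opprK mulr_ge0 // mu_xi_ge0.
rewrite -[X in _ --> X]oppr0.
exact: (eq_seq_cvg (cvgN (cvg_brate_gen f))).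
Qed.

Lemma cvg_sum_Szero : (fun N => \sum_(x in Szero r) mu N (xi N x)) @ \oo --> (1 : R).
Proof.
have h : (fun N => \sum_(x | x \notin Szero r) mu N (xi N x)) @ \oo --> (0 : R).
  rewrite [X in _ --> X](_ : _ = \sum_(x | x \notin Szero r) 0); last by rewrite big1.
  by apply: cvg_sum_seq => x; exact: cvg_transient.
rewrite -[X in _ --> X]subr0; apply: (eq_seq_cvg (cvgB cvg_sum_xi h)) => N.
by rewrite !fctE [X in _ = X - _](bigID (mem (Szero r))) /= addrK.
Qed.

Lemma conclusion_brate :
  irreducible_on (brate r) (Szero r) -> conclusion mu (Szero r) (brate r).
Proof.
move=> irr; apply: limit_chain => //.
- exact: brate_ge0.
- exact: mu_xi_ge0.
- exact: cvg_transient.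
- exact: cvg_sum_Szero.
move=> f; set g := chain_gen (brate r) [set: S] f.
have h : (fun N => \sum_(x | x \notin Szero r) mu N (xi N x) * g x) @ \oo --> (0 : R).
  rewrite [X in _ --> X](_ : _ = \sum_(x | x \notin Szero r) 0 * g x); last first.
    by rewrite big1 // => x _; rewrite mul0r.
  apply: cvg_sum_seq => x x0; apply: cvgM; [exact: cvg_transient|exact: cvg_cst].
rewrite -[X in _ --> X]subr0; apply: (eq_seq_cvg (cvgB (cvg_brate_gen f) h)) => N.
rewrite !fctE [X in _ = X - _](bigID (mem (Szero r))) /= addrK.
apply: eq_bigr => x x0; congr (_ * _); rewrite /g /chain_gen.
(* No b-edge leaves the closed set S_0, so there the full generator agrees with the restricted
   one. *)
rewrite [RHS](bigID (mem (Szero r))) /= [X in _ = _ + X]big1 ?addr0; last first.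
  move=> z /andP[/andP[_ zx] z0].
  have [/eqP ->|bz] := boolP (brate r x z == 0); first by rewrite mul0r.
  by case/negP: z0; exact: recurrent_set_closed x0 (posrel_brate zx bz).
by apply: eq_bigl => z; rewrite finset.in_setT andbC.
Qed.

End FirstTimeScale.

(** Finiteness of [S] turns the strict inequalities into one uniform ratio, which gives the Lyapunov
    functions a definite negative drift. *)
Lemma attracting_ratio (R : realType) (S : finType) (r : S -> S -> R) (A : {set S}) :
  (forall x y, 0 <= r x y) -> attracting r A ->
  exists2 rho : R, 0 <= rho < 1 &
    forall x y, x \in A -> y \notin A -> r x y <= rho * r y x.
Proof.
move=> r0 att; pose P (p : S * S) := (p.1 \in A) && (p.2 \notin A).
(* Since the inverse of 0 is 0, pairs with [r y x = 0] contribute 0; attraction forces [r x y = 0]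
   for them. *)
pose rho : R := \big[Num.max/0]_(p | P p) (r p.1 p.2 / r p.2 p.1).
have lt_or x y : x \in A -> y \notin A -> r y x != 0 -> r x y < r y x.
  by move=> xA yA ryx; apply: att => //; rewrite ltr_wpDl // lt_neqAle eq_sym ryx r0.
exists rho.
  apply/andP; split; first by apply: bigmax_ge_id.
  apply: bigmax_lt => // -[x y] /andP[/= xA yA].
  have [->|ryx] := eqVneq (r y x) 0; first by rewrite invr0 mulr0.
  by rewrite ltr_pdivrMr ?mul1r ?lt_or // lt_neqAle eq_sym ryx r0.
move=> x y xA yA; have [ryx|ryx] := eqVneq (r y x) 0.
  rewrite ryx mulr0 leNgt; apply/negP => rxy.
  by have := att x y xA yA; rewrite ryx addr0 rxy => /(_ isT); rewrite ltNge ltW.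
have ryx0 : 0 < r y x by rewrite lt_neqAle eq_sym ryx r0.
rewrite -ler_pdivrMr //.
by apply: (le_bigmax_cond _ (fun p : S * S => r p.1 p.2 / r p.2 p.1) (j := (x, y)));
  rewrite /P /= xA.
Qed.

(** * How one jump changes the number outside [A] and the occupation of [A] *)

Section Moves.
Variables (R : realType) (S : finType) (A : {set S}) (N : nat).
Implicit Types (eta : config S N).

(** The additive form avoids truncated subtraction. Membership in [HN] bounds [eta x + eta y] by N,
    so [inord] does not overflow at the target. *)
Lemma sigma_nat eta x y z : eta \in HN S N -> y != x -> (0 < eta x)%N ->
  (sigma x y eta z + (z == x) = eta z + (z == y))%N.
Proof.
rewrite inE => /eqP sN yx ex; rewrite /sigma eq_sym yx ex /= ffunE.
have eN : (eta x + eta y <= N)%N.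
  by rewrite -[X in (_ <= X)%N]sN (bigD1 x) //= (bigD1 y) //= addnA leq_addr.
have [->|zx] := eqVneq z x.
  by rewrite eq_sym (negPf yx) inordK; lia.
have [->|zy] := eqVneq z y; first by rewrite inordK; lia.
by [].
Qed.

Lemma sigma_natr eta x y z : eta \in HN S N -> y != x -> (0 < eta x)%N ->
  (sigma x y eta z : nat)%:R = (eta z : nat)%:R + (z == y)%:R - (z == x)%:R :> R.
Proof.
by move=> h yx ex; rewrite -natrD -(sigma_nat z h yx ex) natrD addrK.
Qed.

Definition outside eta : nat := (\sum_(z | z \notin A) eta z)%N.

Lemma outside_sigma eta x y : eta \in HN S N -> y != x -> (0 < eta x)%N ->
  (outside (sigma x y eta) + (x \notin A) = outside eta + (y \notin A))%N.
Proof.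
have ind w : (\sum_(z | z \notin A) (z == w) = (w \notin A))%N.
  have [wA|wA] := boolP (w \notin A).
    rewrite (bigD1 w) //= eqxx big1 // => z /andP[_ zw].
    by rewrite (negPf zw).
  by apply: big1 => z zA; case: eqP => // zw; rewrite -zw zA in wA.
move=> h yx ex; rewrite -!ind /outside -!big_split /=.
by apply: eq_bigr => z _; exact: sigma_nat.
Qed.

Lemma outside_le eta : eta \in HN S N -> (outside eta <= N)%N.
Proof.
rewrite inE => /eqP sN; rewrite -[X in (_ <= X)%N]sN [X in (_ <= X)%N](bigID (mem A)) /=.
by rewrite -/(outside eta) leq_addl.
Qed.

Lemma outside_xi x : x \in A -> outside (xi N x) = 0%N.
Proof.
move=> xA; apply: big1 => z zA; rewrite xiE.
by case: eqP => // zx; rewrite zx xA in zA.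
Qed.

Definition occupied eta : {set S} := [set x in A | (0 < eta x)%N].

Definition spread eta : bool := (1 < #|occupied eta|)%N.

(** Only a jump to an empty site of [A] can enlarge [occupied], and such jumps have rates
    proportional to [d]. *)
Lemma spread_sigma eta x y : eta \in HN S N -> y != x -> (0 < eta x)%N ->
  (y \notin A) || (0 < eta y)%N -> (spread (sigma x y eta) <= spread eta)%N.
Proof.
move=> h yx ex hy.
suff sub : occupied (sigma x y eta) \subset occupied eta.
  rewrite /spread; have := subset_leq_card sub.
  by case: ltnP => // h1 h2; rewrite (leq_trans h1 h2).
apply/fintype.subsetP => z; rewrite !inE => /andP[zA ez]; rewrite zA /=.
have := sigma_nat z h yx ex; have [zy|zy] := eqVneq z y.
  by rewrite -zy zA /= in hy.
by lia.
Qed.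

Lemma spread_xi x : spread (xi N x) = false.
Proof.
apply/negbTE; rewrite -leqNgt; apply: leq_trans (_ : #|[set x]%SET| <= 1)%N.
  apply: subset_leq_card; apply/fintype.subsetP => z; rewrite !inE xiE.
  by case: eqP => // _ /andP[].
by rewrite cards1.
Qed.

Lemma not_spread_eq0 eta x z : ~~ spread eta -> x \in A -> (0 < eta x)%N ->
  z \in A -> z != x -> (eta z : nat) = 0%N.
Proof.
move=> ns xA ex zA zx; apply/eqP; rewrite -leqn0 leqNgt; apply/negP => ez.
case/negP: ns; apply: leq_trans (_ : 1 < #|[set x; z]%SET|)%N _.
  by rewrite cards2 eq_sym zx.
apply: subset_leq_card; apply/fintype.subsetP => w; rewrite !inE.
by case/orP => /eqP ->; rewrite ?xA ?zA.
Qed.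

Variable r : S -> S -> R.

(** Rate, in the part of the generator free of [d], at which particles at [y] outside return to [x]
    in [A]; [crossing] is the W of the overview. *)
Definition crossing_term eta x y : R :=
  if (x \in A) && (y \notin A) then (eta x : nat)%:R * (eta y : nat)%:R * r y x else 0.

Definition crossing eta : R := \sum_x \sum_y crossing_term eta x y.

Hypothesis r0 : forall x y, 0 <= r x y.

Lemma crossing_term_ge0 eta x y : 0 <= crossing_term eta x y.
Proof. by rewrite /crossing_term; case: ifP => // _; rewrite !mulr_ge0. Qed.

Lemma crossing_ge0 eta : 0 <= crossing eta.
Proof.
by apply: sumr_ge0 => x _; apply: sumr_ge0 => y _; exact: crossing_term_ge0.
Qed.

(** Each boundary pair occurs in both orders: [a] accounts for the jump out of [A], [b] for the jump
    back. *)
Lemma sum_crossing_le eta (t : S -> S -> R) a b :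
  (forall x y, y != x -> t x y <= a * crossing_term eta x y + b * crossing_term eta y x) ->
  \sum_x \sum_(y | y != x) t x y <= (a + b) * crossing eta.
Proof.
move=> H.
have diag x : crossing_term eta x x = 0 by rewrite /crossing_term; case: (x \in A).
have -> : (a + b) * crossing eta = \sum_x \sum_(y | y != x)
    (a * crossing_term eta x y + b * crossing_term eta y x).
  rewrite mulrDl {2}/crossing exchange_big /= !mulr_sumr -big_split /=.
  apply: eq_bigr => x _; rewrite !mulr_sumr -big_split /= (bigD1 x) //=.
  by rewrite diag !mulr0 !add0r.
by apply: ler_sum => x _; apply: ler_sum => y; exact: H.
Qed.

Variable rho : R.
Hypothesis rho0 : 0 <= rho.
Hypothesis r_rho : forall x y, x \in A -> y \notin A -> r x y <= rho * r y x.

(** Outward jumps run at most [rho] times as fast as the reverse ones, so both directions are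
    measured by [crossing]. *)
Lemma pair_gen_le (V : config S N -> R) eta gp gm : 0 <= gp ->
  (forall x y, x \in A -> y \notin A -> (0 < eta x)%N -> (0 < eta y)%N ->
     V (sigma x y eta) - V eta <= gp) ->
  (forall x y, x \notin A -> y \in A -> (0 < eta x)%N -> (0 < eta y)%N ->
     V (sigma x y eta) - V eta <= - gm) ->
  (forall x y, (x \in A) = (y \in A) -> y != x -> (0 < eta x)%N -> (0 < eta y)%N ->
     V (sigma x y eta) - V eta <= 0) ->
  pair_gen r V eta <= (rho * gp - gm) * crossing eta.
Proof.
move=> gp0 HAB HBA Hs; apply: sum_crossing_le => x y yx.
have [ex|ex] := posnP (eta x).
  by rewrite /crossing_term ex !mul0r mulr0 mul0r !if_same !mulr0 addr0.
have [ey|ey] := posnP (eta y).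
  by rewrite /crossing_term ey mulr0 !mul0r !if_same !mulr0 addr0.
rewrite /crossing_term; set nn := _%:R * _%:R.
have nn0 : 0 <= nn by rewrite mulr_ge0.
have [xA|xA] := boolP (x \in A); have [yA|yA] := boolP (y \in A) => /=.
- by rewrite !mulr0 addr0 mulr_ge0_le0 ?mulr_ge0 // Hs // xA yA.
- rewrite mulr0 addr0.
  apply: (@le_trans _ _ (nn * r x y * gp)).
    by rewrite ler_wpM2l ?mulr_ge0 // HAB.
  have := ler_wpM2l (mulr_ge0 nn0 gp0) (r_rho xA yA); lra.
- rewrite mulr0 add0r [(eta y : nat)%:R * _]mulrC -/nn [X in _ <= X]mulrC.
  by rewrite ler_wpM2l ?mulr_ge0 // HBA.
- by rewrite !mulr0 addr0 mulr_ge0_le0 ?mulr_ge0 // Hs // (negPf xA) (negPf yA).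
Qed.

End Moves.

(** * Stationary expectations and Lyapunov bounds on returns to [A] *)

Section Expectation.
Variables (R : realType) (S : finType) (N : nat) (mu : config S N -> R).
Implicit Types (h : config S N -> R) (A : {set S}).

Definition expect h : R := \sum_(eta in HN S N) mu eta * h eta.

Lemma expectD h1 h2 : expect (fun t => h1 t + h2 t) = expect h1 + expect h2.
Proof. by rewrite /expect -big_split /=; apply: eq_bigr => t _; rewrite mulrDr. Qed.

Lemma expectZ c h : expect (fun t => c * h t) = c * expect h.
Proof. by rewrite /expect mulr_sumr; apply: eq_bigr => t _; rewrite mulrCA. Qed.

Variables (r : S -> S -> R) (d : R).
Hypothesis mu_inv : invariant_prob r d mu.

Lemma expect_le h1 h2 : (forall eta, eta \in HN S N -> h1 eta <= h2 eta) ->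
  expect h1 <= expect h2.
Proof.
have [mu0 _ _ _] := mu_inv.
by move=> H; apply: ler_sum => t tH; rewrite ler_wpM2l // H.
Qed.

Lemma norm_expect_le h1 h2 : (forall eta, eta \in HN S N -> `|h1 eta| <= h2 eta) ->
  `|expect h1| <= expect h2.
Proof.
have [mu0 _ _ _] := mu_inv => H.
apply: le_trans (ler_norm_sum _ _ _) _; apply: ler_sum => t tH.
by rewrite normrM ger0_norm // ler_wpM2l // H.
Qed.

(** The generator of [V] has mean zero under [mu]; every Lyapunov function is exploited in this
    form. *)
Lemma expect_gen_ge0 (V U : config S N -> R) :
  (forall eta, eta \in HN S N -> gen r d V eta <= U eta) -> 0 <= expect U.
Proof. by have [_ _ _ muG] := mu_inv; rewrite -(muG V); exact: expect_le. Qed.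

Lemma expect1 : expect (fun=> 1) = 1.
Proof.
have [_ muH muS _] := mu_inv; rewrite -[RHS]muS [RHS](bigID (mem (HN S N))) /=.
rewrite [X in _ = _ + X]big1 ?addr0 => [|t tH]; last exact: muH.
by apply: eq_bigr => t _; rewrite mulr1.
Qed.

(** The mass not condensed on a site of [A], the small quantity of the second time scale. *)
Definition defect A : R := 1 - \sum_(x in A) mu (xi N x).

Hypothesis N_gt0 : (0 < N)%N.

Lemma expect_concentrated A h c : (forall eta, eta \in HN S N -> `|h eta| <= c) ->
  `|expect h - \sum_(x in A) mu (xi N x) * h (xi N x)| <= c * defect A.
Proof.
have [mu0 _ _ _] := mu_inv => H.
pose EA := [set xi N x | x in A]%SET.
have EH eta : (eta \in HN S N) && (eta \in EA) = (eta \in EA).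
  by apply: andb_idl => /imsetP[x _ ->]; exact: xi_HN.
have sumEA (k : config S N -> R) :
    \sum_(eta in HN S N) k eta =
    \sum_(x in A) k (xi N x) + \sum_(eta in HN S N | eta \notin EA) k eta.
  rewrite (bigID (mem EA)) /= (eq_bigl _ _ EH) /= big_imset //=.
  by move=> x y _ _; exact: xi_inj.
rewrite /expect sumEA addrC addKr.
have -> : c * defect A = \sum_(eta in HN S N | eta \notin EA) mu eta * c.
  rewrite -mulr_suml [RHS]mulrC /defect -expect1 /expect sumEA; congr (_ * _).
  under [X in X + _ - _]eq_bigr do rewrite mulr1.
  under [X in _ + X - _]eq_bigr do rewrite mulr1.
  by rewrite addrC addKr.
apply: le_trans (ler_norm_sum _ _ _) _; apply: ler_sum => t /andP[tH _].
by rewrite normrM ger0_norm // ler_wpM2l // H.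
Qed.

Lemma expect_defect_le A h c : (forall eta, eta \in HN S N -> 0 <= h eta <= c) ->
  (forall x, x \in A -> h (xi N x) = 0) -> expect h <= c * defect A.
Proof.
move=> H Hxi; have := @expect_concentrated A h c.
rewrite big1 => [|x xA]; last by rewrite Hxi // mulr0.
rewrite subr0 => h1; apply: le_trans (ler_norm _) (h1 _) => t tH.
by have /andP[h0 hc] := H t tH; rewrite ger0_norm.
Qed.

Variables (A : {set S}) (rho : R).
Hypothesis r0 : forall x y, 0 <= r x y.
Hypothesis d0 : 0 < d.
Hypothesis rho01 : 0 <= rho < 1.
Hypothesis r_rho : forall x y, x \in A -> y \notin A -> r x y <= rho * r y x.

Local Notation Rt := (total_rate r).
Local Notation W := (@crossing R S A N r).
Local Notation out := (@outside S A N).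
Local Notation spr := (@spread S A N).

Lemma gen_le (V : config S N -> R) eta gp gm e :
  eta \in HN S N -> 0 <= gp -> gp <= e ->
  (forall x y, x \in A -> y \notin A -> (0 < eta x)%N ->
     V (sigma x y eta) - V eta <= gp) ->
  (forall x y, x \notin A -> y \in A -> (0 < eta x)%N -> (0 < eta y)%N ->
     V (sigma x y eta) - V eta <= - gm) ->
  (forall x y, (x \in A) = (y \in A) -> y != x -> (0 < eta x)%N -> (0 < eta y)%N ->
     V (sigma x y eta) - V eta <= 0) ->
  (forall x y, y \in A -> y != x -> (0 < eta x)%N ->
     V (sigma x y eta) - V eta <= e) ->
  (forall x y, x \notin A -> y \notin A -> y != x -> (0 < eta x)%N ->
     V (sigma x y eta) - V eta <= e) ->
  gen r d V eta <= (rho * gp - gm) * W eta + d * (Rt * (N%:R * e)).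
Proof.
have /andP[rho0 _] := rho01.
move=> etaH gp0 gpe HAB HBA Hs He1 He2; rewrite genE; apply: lerD.
  by apply: pair_gen_le => // x y xA yA ex _; exact: HAB.
rewrite ler_pM2l //; apply: walk_gen_le => //; first exact: le_trans gp0 gpe.
move=> x y yx ex; have [yA|yA] := boolP (y \in A); first exact: He1.
have [xA|xA] := boolP (x \in A); last exact: He2.
by apply: le_trans gpe; exact: HAB.
Qed.

Lemma outside_leave eta x y : eta \in HN S N -> x \in A -> y \notin A ->
  (0 < eta x)%N -> out (sigma x y eta) = (out eta).+1.
Proof.
move=> h xA yA ex; have yx : y != x by apply: contraNneq yA => ->.
by have := outside_sigma A h yx ex; rewrite xA yA addn0 addn1.
Qed.

Lemma outside_enter eta x y : eta \in HN S N -> x \notin A -> y \in A ->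
  (0 < eta x)%N -> (out (sigma x y eta)).+1 = out eta.
Proof.
move=> h xA yA ex; have yx : y != x by apply: contraNneq xA => <-.
by have := outside_sigma A h yx ex; rewrite xA yA addn0 addn1.
Qed.

Lemma outside_same eta x y : eta \in HN S N -> (x \in A) = (y \in A) -> y != x ->
  (0 < eta x)%N -> out (sigma x y eta) = out eta.
Proof.
by move=> h xy yx ex; have := outside_sigma A h yx ex; rewrite xy => /addIn.
Qed.

(** With m particles outside, the Lyapunov function is the sum of [g j] over j < m: an exit adds
    [g m], a return removes [g (m - 1)]. *)
Lemma expect_crossing_ge0 (g : nat -> R) : (forall j, 0 <= g j) ->
  0 <= expect (fun t => (rho * g (out t) - g (out t).-1) * W t
                 + d * (Rt * (N%:R * g (out t)))).
Proof.
move=> g0; apply: (@expect_gen_ge0 (fun t => \sum_(j < out t) g j)) => t tH.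
have enter x y : x \notin A -> y \in A -> (0 < t x)%N ->
    \sum_(j < out (sigma x y t)) g j - \sum_(j < out t) g j = - g (out t).-1.
  move=> xA yA ex; rewrite -(outside_enter tH xA yA ex) big_ord_recr /=.
  by rewrite opprD addrA subrr add0r.
apply: gen_le => //.
- by move=> x y xA yA ex; rewrite outside_leave // big_ord_recr /= addrAC subrr add0r.
- by move=> x y xA yA ex _; rewrite enter.
- by move=> x y xy yx ex _; rewrite outside_same // subrr.
- move=> x y yA yx ex; have [xA|xA] := boolP (x \in A).
    by rewrite outside_same // ?xA ?yA // subrr.
  by rewrite enter // (le_trans _ (g0 _)) // oppr_le0.
- by move=> x y xA yA yx ex; rewrite outside_same // ?(negPf xA) ?(negPf yA) // subrr.
Qed.

Lemma expect_crossing : (1 - rho) * expect W <= d * Rt * N%:R.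
Proof.
have := @expect_crossing_ge0 (fun=> 1) (fun=> ler01).
rewrite expectD [X in _ <= X + _](_ : _ = (rho - 1) * expect W); last first.
  by rewrite -expectZ /expect; apply: eq_bigr => t _; rewrite mulr1.
have := expectZ (d * (Rt * (N%:R * 1))) (fun=> 1); rewrite expect1 !mulr1 => ->.
by lra.
Qed.

Variable M : nat.

Definition ramp (j : nat) : R := Num.min (j%:R / M%:R) 1.

Lemma ramp_ge0 j : 0 <= ramp j.
Proof. by rewrite /ramp le_min ler01 divr_ge0. Qed.

Lemma ramp_le1 j : ramp j <= 1.
Proof. by rewrite /ramp ge_min lexx orbT. Qed.

Lemma ramp_pred j : ramp j <= ramp j.-1 + M%:R^-1.
Proof.
case: j => [|j] /=; first by rewrite lerDl invr_ge0.
have M0 : 0 <= M%:R^-1 :> R by rewrite invr_ge0.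
rewrite /ramp -natr1 mulrDl mul1r; set u := j%:R / M%:R.
by rewrite [X in _ <= X + _]minEle; case: ifP => h; rewrite ge_min ?lexx ?lerDl ?M0 ?orbT.
Qed.

Lemma ramp1 j : (0 < M)%N -> (M <= j)%N -> ramp j = 1.
Proof.
move=> M_gt0 Mj; rewrite /ramp; apply/min_idPr.
by rewrite ler_pdivlMr ?mul1r ?ler_nat // ltr0n.
Qed.

(** The slope of [ramp] is at most 1/M, so replacing [g (m - 1)] by [g m] costs W / M. In the walk
    part [ramp] vanishes at the condensates of [A], which leaves only [defect]. *)
Lemma expect_crossing_ramp :
  (1 - rho) * expect (fun t => ramp (out t) * W t)
  <= expect W / M%:R + d * Rt * N%:R * defect A.
Proof.
have /andP[rho0 rho1] := rho01.
have E1 := @expect_crossing_ge0 ramp ramp_ge0.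
have E2 : expect (fun t => ramp (out t)) <= 1 * defect A.
  apply: expect_defect_le => [t _|x xA]; first by rewrite ramp_ge0 ramp_le1.
  by rewrite outside_xi // /ramp mul0r min_l.
have E3 : expect (fun t => (rho * ramp (out t) - ramp (out t).-1) * W t
       + d * (Rt * (N%:R * ramp (out t))))
    <= - (1 - rho) * expect (fun t => ramp (out t) * W t) + M%:R^-1 * expect W
       + d * Rt * N%:R * expect (fun t => ramp (out t)).
  rewrite -!expectZ -!expectD; apply: expect_le => t tH.
  rewrite !mulrA lerD2r -mulrDl ler_wpM2r ?crossing_ge0 //.
  by have := ramp_pred (out t); lra.
have c0 : 0 <= d * Rt * N%:R.
  by rewrite !mulr_ge0 ?total_rate_ge0 // ltW.
have := ler_wpM2l c0 E2; rewrite mul1r; lra.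
Qed.

Lemma expect_crossing_spread :
  (1 - rho) * expect (fun t => (spr t && (out t <= M)%N)%:R * W t)
  <= d * Rt * N%:R * (M.+1%:R * defect A).
Proof.
have /andP[rho0 rho1] := rho01.
(* While [spread] holds and m <= M, a return lowers [V] by at least 1; above M the cap leaves
   nothing to gain from an exit. *)
pose V (t : config S N) : R := (minn (out t) M * spr t)%N%:R.
pose g (t : config S N) : R := (spr t && (out t <= M)%N)%:R.
(* The term [spr t] covers an exit from a spread configuration; M, needed only when m > 0, covers a
   jump that creates [spread]. At the condensates of [A] both vanish. *)
pose e (t : config S N) : R := (spr t + M * (0 < out t))%N%:R.
have E1 : 0 <= expect (fun t => (rho - 1) * (g t * W t) + d * (Rt * (N%:R * e t))).
  apply: (@expect_gen_ge0 V) => t tH; rewrite mulrA mulrBl mul1r.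
  pose gp : R := (spr t && (out t < M)%N)%:R.
  apply: (@le_trans _ _ ((rho * gp - g t) * W t + d * (Rt * (N%:R * e t)))); last first.
    rewrite lerD2r ler_wpM2r ?crossing_ge0 // lerD2r ler_wpM2l // ler_nat.
    by case: (spr t) => //=; case: ltngtP.
  have dV x y k : (minn (out (sigma x y t)) M * spr (sigma x y t)
      <= minn (out t) M * spr t + k)%N -> V (sigma x y t) - V t <= k%:R.
    by move=> h; rewrite lerBlDl -natrD ler_nat.
  apply: gen_le => //.
  - by rewrite /gp /e ler_nat; case: (spr t) => //=; case: ltnP.
  - move=> x y xA yA ex; apply: dV; rewrite outside_leave //.
    have yx : y != x by apply: contraNneq yA => ->.
    have := @spread_sigma S A N t x y tH yx ex; rewrite yA => /(_ isT).
    by case: (spr t); case: (spr _) => // _; rewrite ?muln0 //= ?muln1; case: ltnP; lia.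
  - move=> x y xA yA ex ey.
    have yx : y != x by apply: contraNneq xA => <-.
    have := @spread_sigma S A N t x y tH yx ex; rewrite ey orbT => /(_ isT).
    have oe := outside_enter tH xA yA ex.
    rewrite lerBlDr addrC lerBrDr /V /g -natrD ler_nat.
    by case: (spr t); case: (spr _) => // _; rewrite ?muln0 //= ?muln1; case: leqP; lia.
  - move=> x y xy yx ex ey; apply: (@dV x y 0%N); rewrite outside_same // addn0.
    have := @spread_sigma S A N t x y tH yx ex; rewrite ey orbT => /(_ isT) h.
    by rewrite leq_mul2l h orbT.
  - move=> x y yA yx ex; apply: dV.
    have [xA|xA] := boolP (x \in A).
      rewrite outside_same // ?xA ?yA //.
      by case: (spr t); case: (spr _); rewrite ?muln0 ?muln1; case: posnP; lia.
    have oe := outside_enter tH xA yA ex.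
    by case: (spr t); case: (spr _); rewrite ?muln0 ?muln1; case: posnP; lia.
  - move=> x y xA yA yx ex; apply: dV; rewrite outside_same // ?(negPf xA) ?(negPf yA) //.
    have := @spread_sigma S A N t x y tH yx ex; rewrite yA => /(_ isT) h.
    by apply: leq_trans (leq_addr _ _); rewrite leq_mul2l h orbT.
have E2 : expect e <= M.+1%:R * defect A.
  apply: expect_defect_le => [t _|x xA].
    by rewrite /e ler0n ler_nat; case: (spr t); case: (0 < _)%N; lia.
  by rewrite /e spread_xi outside_xi // muln0.
have E3 : expect (fun t => (rho - 1) * (g t * W t) + d * (Rt * (N%:R * e t)))
    = - (1 - rho) * expect (fun t => g t * W t) + d * Rt * N%:R * expect e.
  rewrite expectD -!expectZ opprB; congr (_ + _).
  by rewrite /expect; apply: eq_bigr => t _; rewrite !mulrA.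
have c0 : 0 <= d * Rt * N%:R.
  by rewrite !mulr_ge0 ?total_rate_ge0 // ltW.
have := ler_wpM2l c0 E2; move: E1; rewrite E3 /g; lra.
Qed.

End Expectation.

(** * The second time scale at fixed N and M *)

Section TestFunction.
Variables (R : realType) (S : finType) (A : {set S}) (N : nat).
Variables (r : S -> S -> R) (f : S -> R) (K : R).
Hypothesis r0 : forall x y, 0 <= r x y.
Hypothesis fK : forall x, `|f x| <= K.
Hypothesis K0 : 0 <= K.
Hypothesis N_gt0 : (0 < N)%N.
Hypothesis r_sym : forall x y, x \in A -> y \in A -> r x y = r y x.

Local Notation out := (@outside S A N).
Local Notation spr := (@spread S A N).
Local Notation W := (@crossing R S A N r).

Definition weight (t : config S N) : R := \sum_(z in A) f z * (t z : nat)%:R.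

(* [weight / (N - out)] would be the natural interpolation of f; the factor
   [(N + out) / N ^ 2] agrees with [1 / (N - out)] to first order in [out / N]. *)
Definition test (t : config S N) : R := weight t * (N + out t)%:R.

Lemma weight_sigma t x y : t \in HN S N -> y != x -> (0 < t x)%N ->
  weight (sigma x y t) =
  weight t + (if y \in A then f y else 0) - (if x \in A then f x else 0).
Proof.
have ind w : (if w \in A then f w else 0) = \sum_(z in A) f z * (z == w)%:R.
  have [wA|wA] := boolP (w \in A).
    rewrite (bigD1 w) //= eqxx mulr1 big1 ?addr0 // => z /andP[_ zw].
    by rewrite (negPf zw) mulr0.
  rewrite big1 // => z zA; case: eqP => [zw|_]; last by rewrite mulr0.
  by rewrite -zw zA in wA.
move=> h yx ex; rewrite !ind /weight -big_split -sumrB /=.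
by apply: eq_bigr => z _; rewrite (sigma_natr R z h yx ex); ring.
Qed.

Lemma test_inside t x y : t \in HN S N -> x \in A -> y \in A -> y != x ->
  (0 < t x)%N -> test (sigma x y t) - test t = (N + out t)%:R * (f y - f x).
Proof.
move=> h xA yA yx ex; rewrite /test weight_sigma // xA yA.
by rewrite outside_same // ?xA ?yA //; ring.
Qed.

Lemma test_outside t x y : t \in HN S N -> x \notin A -> y \notin A -> y != x ->
  (0 < t x)%N -> test (sigma x y t) - test t = 0.
Proof.
move=> h xA yA yx ex; rewrite /test weight_sigma // (negPf xA) (negPf yA).
by rewrite outside_same // ?(negPf xA) ?(negPf yA) //; ring.
Qed.

(** Near [xi N x] the weight is close to [f x * N], so the terms of order N cancel; the factor N + m
    is chosen for this. *)
Lemma test_leave t x y : t \in HN S N -> x \in A -> y \notin A -> (0 < t x)%N ->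
  test (sigma x y t) - test t = (weight t - f x * N%:R) - f x * (out t).+1%:R.
Proof.
move=> h xA yA ex; have yx : y != x by apply: contraNneq yA => ->.
rewrite /test weight_sigma // xA (negPf yA) outside_leave //.
by rewrite !natrD -!natr1; ring.
Qed.

Lemma test_enter t x y : t \in HN S N -> x \notin A -> y \in A -> (0 < t x)%N ->
  test (sigma x y t) - test t = - (weight t - f y * N%:R) + f y * (out t).-1%:R.
Proof.
move=> h xA yA ex; have yx : y != x by apply: contraNneq xA => <-.
rewrite /test weight_sigma // yA (negPf xA) -(outside_enter h xA yA ex) /=.
by rewrite !natrD -!natr1; ring.
Qed.

Lemma weight_le t : t \in HN S N -> `|weight t| <= K * N%:R.
Proof.
rewrite inE => /eqP sN; apply: le_trans (ler_norm_sum _ _ _) _.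
rewrite -[X in _ <= _ * X%:R]sN natr_sum mulr_sumr big_mkcond /=.
apply: ler_sum => z _; case: ifP => _; last by rewrite mulr_ge0.
by rewrite normrM normr_nat ler_wpM2r.
Qed.

(** Without [spread], all particles in [A] sit at [x] and the weight is exactly f(x) (N - m);
    otherwise a crude bound of order N is accepted. *)
Lemma weight_near t x : t \in HN S N -> x \in A -> (0 < t x)%N ->
  `|weight t - f x * N%:R| <= 2 * K * N%:R * (spr t)%:R + K * (out t)%:R.
Proof.
move=> h xA ex; have sN : (\sum_z (t z : nat))%N = N by apply/eqP; move: h; rewrite inE.
have eN : N%:R = \sum_(z in A) (t z : nat)%:R + (out t)%:R :> R.
  by rewrite -[X in X%:R = _]sN (bigID (mem A)) /= natrD natr_sum.
have -> : weight t - f x * N%:R =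
    \sum_(z in A) (f z - f x) * (t z : nat)%:R - f x * (out t)%:R.
  rewrite eN mulrDr opprD addrA mulr_sumr -sumrB; congr (_ - _).
  by apply: eq_bigr => z _; ring.
apply: le_trans (ler_normB _ _) _; apply: lerD; last first.
  by rewrite normrM normr_nat ler_wpM2r.
have [sp|sp] := boolP (spr t); last first.
  rewrite mulr0 big1 ?normr0 // => z zA; have [->|zx] := eqVneq z x.
    by rewrite subrr mul0r.
  by rewrite (not_spread_eq0 sp xA ex zA zx) mulr0.
rewrite mulr1; apply: le_trans (ler_norm_sum _ _ _) _.
apply: (@le_trans _ _ (\sum_(z in A) 2 * K * (t z : nat)%:R)).
  apply: ler_sum => z _; rewrite normrM normr_nat ler_wpM2r //.
  by apply: le_trans (ler_normB _ _) _; have := fK z; have := fK x; lra.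
by rewrite -mulr_sumr eN ler_wpM2l ?mulr_ge0 // lerDl.
Qed.

Lemma test_move_le t x y : t \in HN S N -> y != x -> (0 < t x)%N ->
  `|test (sigma x y t) - test t| <= 4 * K * N%:R.
Proof.
move=> h yx ex; have ow := outside_le A h.
have owR : (out t)%:R <= N%:R :> R by rewrite ler_nat.
have N1 : 1 <= N%:R :> R by rewrite ler1n.
have n0 : 0 <= (out t)%:R :> R by [].
have fx := fK x; have fy := fK y; have wt := weight_le h.
have KN : K <= K * N%:R by rewrite ler_peMr.
have KO : K * (out t)%:R <= K * N%:R by rewrite ler_wpM2l.
have tri (w g : R) (k : nat) : `|w| <= K * N%:R -> `|g| <= K ->
    (k <= N.+1)%N -> `|w - g * N%:R - g * k%:R| <= 4 * K * N%:R.
  move=> hw hg hk; apply: le_trans (ler_normB _ _) _.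
  apply: le_trans (lerD (ler_normB _ _) (lexx _)) _.
  rewrite !normrM !normr_nat.
  have : `|g| * N%:R <= K * N%:R by rewrite ler_wpM2r.
  have : `|g| * k%:R <= K * (N%:R + 1).
    by rewrite ler_pM // natr1 ler_nat.
  by lra.
have [xA|xA] := boolP (x \in A); have [yA|yA] := boolP (y \in A).
- rewrite test_inside // normrM normr_nat natrD.
  have d2 : `|f y - f x| <= 2 * K by apply: le_trans (ler_normB _ _) _; lra.
  have : (N%:R + (out t)%:R) * `|f y - f x| <= (2 * N%:R) * (2 * K).
    by apply: ler_pM => //; lra.
  by lra.
- by rewrite test_leave //; apply: tri.
- rewrite test_enter // -normrN opprD opprK.
  by apply: tri => //; apply: leq_trans (leq_pred _) _; exact: leqW.
- by rewrite test_outside // normr0 !mulr_ge0.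
Qed.

Definition cross_term (t : config S N) x y : R :=
  if (x \in A) == (y \in A) then 0
  else (t x : nat)%:R * (t y : nat)%:R * r x y * (test (sigma x y t) - test t).

(** Inside [A] the rates are symmetric in [x] and [y] while the increments are antisymmetric, so
    these terms cancel; jumps outside [A] leave [test] unchanged. *)
Lemma pair_gen_test t : t \in HN S N ->
  pair_gen r test t = \sum_x \sum_(y | y != x) cross_term t x y.
Proof.
move=> h.
pose aa x y : R := if (x \in A) && (y \in A) then
  (t x : nat)%:R * (t y : nat)%:R * r x y * ((N + out t)%:R * (f y - f x)) else 0.
have aa0 : \sum_x \sum_(y | y != x) aa x y = 0.
  have -> : \sum_x \sum_(y | y != x) aa x y = \sum_x \sum_y aa x y.
    apply: eq_bigr => x _; rewrite [RHS](bigD1 x) //= {2}/aa subrr !mulr0 if_same.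
    by rewrite add0r.
  have anti : \sum_x \sum_y aa x y = - \sum_x \sum_y aa x y.
    rewrite {1}exchange_big /= -sumrN; apply: eq_bigr => x _; rewrite -sumrN.
    apply: eq_bigr => y _; rewrite /aa andbC; case: ifP => [/andP[xA yA]|_].
      by rewrite (r_sym xA yA); ring.
    by rewrite oppr0.
  by move: anti; lra.
rewrite -[RHS]add0r -[X in _ = X + _]aa0 -big_split /=; apply: eq_bigr => x _.
rewrite -big_split /=; apply: eq_bigr => y yx.
rewrite /aa /cross_term; have [ex|ex] := posnP (t x).
  by rewrite ex !mul0r !if_same addr0.
have [xA|xA] := boolP (x \in A); have [yA|yA] := boolP (y \in A) => /=.
- by rewrite test_inside // addr0.
- by rewrite add0r.
- by rewrite add0r.
- by rewrite test_outside // mulr0 addr0.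
Qed.

Hypothesis r_out : forall x y, x \in A -> y \notin A -> r x y <= r y x.

Lemma norm_pair_gen_test t : t \in HN S N ->
  `|pair_gen r test t|
  <= 4 * K * (N%:R * (spr t)%:R + (out t)%:R + 1) * W t.
Proof.
move=> h; rewrite pair_gen_test //; set Q := N%:R * _ + _ + 1.
(* One half of the constant for each direction of crossing. *)
have -> : 4 * K * Q = 2 * K * Q + 2 * K * Q by ring.
apply: le_trans (ler_norm_sum _ _ _) _.
apply: le_trans (_ : _ <= \sum_x \sum_(y | y != x) `|cross_term t x y|) _.
  by apply: ler_sum => x _; exact: ler_norm_sum.
have sp0 : 0 <= K * N%:R * (spr t)%:R by rewrite !mulr_ge0.
have ko0 : 0 <= K * (out t)%:R by rewrite mulr_ge0.
have Q0 : 0 <= 2 * K * Q by rewrite mulr_ge0 ?mulr_ge0 // !addr_ge0 // mulr_ge0.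
apply: sum_crossing_le => x y yx.
have [ex|ex] := posnP (t x).
  rewrite /cross_term ex !mul0r if_same normr0.
  by rewrite addr_ge0 // mulr_ge0 // crossing_term_ge0.
have [ey|ey] := posnP (t y).
  rewrite /cross_term ey mulr0 !mul0r if_same normr0.
  by rewrite addr_ge0 // mulr_ge0 // crossing_term_ge0.
rewrite /cross_term /crossing_term; set nn := _%:R * _%:R.
have nn0 : 0 <= nn by rewrite mulr_ge0.
have [xA|xA] := boolP (x \in A); have [yA|yA] := boolP (y \in A) => /=.
- by rewrite normr0 !mulr0 addr0.
- rewrite mulr0 addr0 normrM ger0_norm ?mulr_ge0 // mulrC.
  apply: ler_pM => //; first by rewrite mulr_ge0.
    rewrite test_leave //; apply: le_trans (ler_normB _ _) _.
    have := weight_near h xA ex; rewrite normrM normr_nat.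
    have : `|f x| * (out t).+1%:R <= K * ((out t)%:R + 1) by rewrite natr1 ler_wpM2r.
    by move: K0; rewrite /Q; set X := `|f x| * _; lra.
  by rewrite ler_wpM2l // r_out.
- rewrite mulr0 add0r normrM ger0_norm ?mulr_ge0 // mulrC.
  rewrite [(t y : nat)%:R * _]mulrC -/nn.
  rewrite ler_wpM2r ?mulr_ge0 //.
  rewrite test_enter //; apply: le_trans (ler_normD _ _) _; rewrite normrN.
  have := weight_near h yA ey; rewrite normrM normr_nat.
  have : `|f y| * (out t).-1%:R <= K * (out t)%:R by rewrite ler_pM // ler_nat leq_pred.
  by move: K0; rewrite /Q; set X := `|f y| * _; lra.
- by rewrite normr0 !mulr0 addr0.
Qed.

(** A jump inside [A] changes [test] by order N at a rate of order N; an exit changes it by only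
    [- f x], hence the two powers of N. *)
Lemma walk_gen_test_xi x : x \in A ->
  walk_gen r test (xi N x) =
  N%:R ^+ 2 * chain_gen r A f x - N%:R * (f x * \sum_(y | y \notin A) r x y).
Proof.
move=> xA; have h := xi_HN N x.
have ex : (0 < xi N x x)%N by rewrite xiE eqxx.
have wx : weight (xi N x) = f x * N%:R.
  rewrite /weight (bigD1 x) //= xiE eqxx big1 ?addr0 // => z /andP[_ zx].
  by rewrite xiE (negPf zx) mulr0.
rewrite /walk_gen (bigD1 x) //= [X in _ + X]big1 ?addr0; last first.
  by move=> z zx; apply: big1 => w _; rewrite xiE (negPf zx) !mul0r.
rewrite (bigID (mem A)) /=; congr (_ + _).
  rewrite /chain_gen mulr_sumr [RHS](eq_bigl (fun y => (y != x) && (y \in A))); last first.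
    by move=> y; rewrite andbC.
  apply: eq_bigr => y /andP[yx yA].
  by rewrite test_inside // xiE eqxx outside_xi // addn0; ring.
rewrite mulr_sumr mulr_sumr -sumrN; apply: eq_big => y.
  by rewrite andb_idl // => yA; apply: contraNneq yA => ->.
move=> /andP[yx yA].
by rewrite test_leave // wx xiE eqxx outside_xi //; ring.
Qed.

Variables (d : R) (mu : config S N -> R) (rho : R) (M : nat).
Hypothesis d0 : 0 < d.
Hypothesis mu_inv : invariant_prob r d mu.
Hypothesis rho01 : 0 <= rho < 1.
Hypothesis r_rho : forall x y, x \in A -> y \notin A -> r x y <= rho * r y x.
Hypothesis M_gt0 : (0 < M)%N.

Local Notation Rt := (total_rate r).
Local Notation a := (defect mu A).
Local Notation ex := (expect mu).

Lemma defect_ge0 : 0 <= a.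
Proof.
have := @expect_defect_le R S N mu r d mu_inv N_gt0 A (fun=> 0) 1.
rewrite mul1r => h; apply: le_trans (h _ _) => //.
  by rewrite /expect big1 // => t _; rewrite mulr0.
by move=> t _; rewrite lexx ler01.
Qed.

(** If m <= M, the crossing bound needs the [spread] estimate and m <= M; if m > M, everything is
    below 2 N [ramp]. The factor 1 - [rho] is squared because the [ramp] estimate itself uses the
    bound on the mean of W. *)
Lemma expect_pair_gen_test :
  (1 - rho) ^+ 2 * `|ex (pair_gen r test)| <=
  4 * K * (d * Rt * N%:R) *
  (N%:R * (M.+3%:R * a + 2 / M%:R) + M.+1%:R).
Proof.
have /andP[rho0 rho1] := rho01; have a0 := defect_ge0.
set c := 1 - rho; have c0 : 0 < c by rewrite subr_gt0.
have c1 : c <= 1 by rewrite /c; lra.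
set D := d * Rt * N%:R.
have D0 : 0 <= D by rewrite !mulr_ge0 ?total_rate_ge0 // ltW.
pose G1 t := (spr t && (out t <= M)%N)%:R * W t.
pose Gr t := ramp R M (out t) * W t.
have E0 : `|ex (pair_gen r test)| <=
    4 * K * (N%:R * ex G1 + 2 * N%:R * ex Gr + M.+1%:R * ex W).
  rewrite -!expectZ -!expectD -expectZ; apply: (norm_expect_le mu_inv) => t tH.
  apply: le_trans (norm_pair_gen_test tH) _.
  have -> : 4 * K * (N%:R * G1 t + 2 * N%:R * Gr t + M.+1%:R * W t) =
    4 * K * (N%:R * (spr t && (out t <= M)%N)%:R + 2 * N%:R * ramp R M (out t)
      + M.+1%:R) * W t by rewrite /G1 /Gr; ring.
  rewrite ler_wpM2r ?crossing_ge0 // ler_wpM2l ?mulr_ge0 // -[M.+1%:R]natr1 addrA lerD2r.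
  have ra0 := mulr_ge0 (ler0n R N) (ramp_ge0 R M (out t)).
  have [oM|Mo] := leqP (out t) M.
    rewrite andbT; have : (out t)%:R <= M%:R :> R by rewrite ler_nat.
    by lra.
  rewrite andbF mulr0 add0r ramp1 ?(ltnW Mo) // mulr1.
  have : (out t)%:R <= N%:R :> R by rewrite ler_nat outside_le.
  have : N%:R * (spr t)%:R <= N%:R :> R by rewrite ler_piMr //; case: (spr t).
  have : 0 <= M%:R :> R by [].
  by lra.
have EW : c * ex W <= D by exact: (expect_crossing mu_inv r0 d0 rho01 r_rho).
have Er : c * ex Gr <= ex W / M%:R + D * a.
  exact: (expect_crossing_ramp mu_inv N_gt0 r0 d0 rho01 r_rho M).
have Es : c * ex G1 <= D * (M.+1%:R * a).
  exact: (expect_crossing_spread mu_inv N_gt0 r0 d0 rho01 r_rho M).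
have Da0 : 0 <= D * a by rewrite mulr_ge0.
have EW2 : c ^+ 2 * ex W <= D.
  rewrite expr2 -mulrA; apply: le_trans (_ : c * D <= D); first by rewrite ler_pM2l.
  by rewrite ler_piMl.
have Es2 : c ^+ 2 * ex G1 <= D * (M.+1%:R * a).
  rewrite expr2 -mulrA; apply: le_trans (_ : c * (D * (M.+1%:R * a)) <= _).
    by rewrite ler_pM2l.
  by rewrite ler_piMl // mulr_ge0 // mulr_ge0.
have Er2 : c ^+ 2 * ex Gr <= D / M%:R + D * a.
  rewrite expr2 -mulrA; apply: le_trans (_ : c * (ex W / M%:R + D * a) <= _).
    by rewrite ler_pM2l.
  rewrite mulrDr mulrA; apply: lerD; first by rewrite ler_wpM2r ?invr_ge0.
  by rewrite ler_piMl.
have c20 : 0 <= c ^+ 2 by rewrite exprn_ge0 // ltW.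
apply: le_trans (ler_wpM2l c20 E0) _.
have -> : c ^+ 2 * (4 * K * (N%:R * ex G1 + 2 * N%:R * ex Gr + M.+1%:R * ex W)) =
  4 * K * (N%:R * (c ^+ 2 * ex G1) + 2 * N%:R * (c ^+ 2 * ex Gr)
    + M.+1%:R * (c ^+ 2 * ex W)) by ring.
rewrite -[4 * K * D * _]mulrA ler_wpM2l ?mulr_ge0 //.
have -> : D * (N%:R * (M.+3%:R * a + 2 / M%:R) + M.+1%:R) =
   N%:R * (D * (M.+1%:R * a)) + 2 * N%:R * (D / M%:R + D * a) + M.+1%:R * D.
  by rewrite -(addn2 M.+1) natrD; ring.
apply: lerD; last by rewrite ler_wpM2l.
by apply: lerD; rewrite ler_wpM2l // mulr_ge0.
Qed.

(** The pair part has mean of order [d], so [d] cancels from stationarity and bounds the mean of the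
    walk part. Concentration replaces that mean by its value on condensates, N^2 I - N Z, and
    division by N^2 isolates I. *)
Lemma second_scale_estimate :
  `|\sum_(x in A) mu (xi N x) * chain_gen r A f x| <=
  (8 * K * Rt / (1 - rho) ^+ 2 + 4 * K * Rt) *
    (M%:R^-1 + M.+3%:R * (a + N%:R^-1)).
Proof.
have /andP[rho0 rho1] := rho01; have a0 := defect_ge0.
have Rt0 := total_rate_ge0 r0.
have NR : 0 < N%:R :> R by rewrite ltr0n.
have [mu0 _ _ muG] := mu_inv; have mu1 := invariant_prob_le1 mu_inv.
set c2 := (1 - rho) ^+ 2; have c20 : 0 < c2 by rewrite exprn_gt0 // subr_gt0.
set I := \sum_(x in A) _.
have E0 : ex (pair_gen r test) + d * ex (walk_gen r test) = 0.
  rewrite -(muG test) -expectZ -expectD; apply: eq_bigr => t _.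
  by rewrite genE.
set P := ex (pair_gen r test) in E0; set Wk := ex (walk_gen r test) in E0.
have EP := expect_pair_gen_test; rewrite -/P -/c2 in EP.
set J := \sum_(x in A) mu (xi N x) * walk_gen r test (xi N x).
have EJ : `|Wk - J| <= Rt * (N%:R * (4 * K * N%:R)) * a.
  apply: (expect_concentrated mu_inv N_gt0) => t tH.
  apply: norm_walk_gen_le => //; first by rewrite !mulr_ge0.
  by move=> x y yx ex0; exact: test_move_le.
set Z := \sum_(x in A) mu (xi N x) * (f x * \sum_(y | y \notin A) r x y).
have JE : J = N%:R ^+ 2 * I - N%:R * Z.
  rewrite /J /I /Z !mulr_sumr -sumrB; apply: eq_bigr => x xA.
  by rewrite walk_gen_test_xi //; ring.
have EZ : `|Z| <= K * Rt.
  apply: le_trans (ler_norm_sum _ _ _) _; rewrite /total_rate mulr_sumr big_mkcond /=.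
  apply: ler_sum => x _.
  have s0 (P0 : pred S) : 0 <= \sum_(y | P0 y) r x y by rewrite sumr_ge0.
  case: ifP => xA; last by rewrite mulr_ge0.
  rewrite !normrM (ger0_norm (mu0 _)) (ger0_norm (s0 _)).
  apply: le_trans (_ : 1 * (`|f x| * \sum_(y | y \notin A) r x y) <= _).
    by rewrite ler_wpM2r // mulr_ge0.
  rewrite mul1r ler_pM // big_mkcond [X in _ <= X]big_mkcond /=.
  apply: ler_sum => y _; case: ifP => yA; case: ifP => // yx.
  by move: yA; rewrite (eqP (negbFE yx)) xA.
have PE : P = - (d * Wk) by apply/eqP; rewrite -addr_eq0 E0.
have EW : c2 * `|Wk| <= 4 * K * (Rt * N%:R) *
    (N%:R * (M.+3%:R * a + 2 / M%:R) + M.+1%:R).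
  rewrite -(ler_pM2l d0).
  by move: EP; rewrite PE normrN normrM (gtr0_norm d0); lra.
pose u : R := M%:R^-1; pose v : R := N%:R^-1; pose T : R := M.+3%:R.
pose k := K * Rt; pose kc := k / c2.
have u0 : 0 <= u by rewrite invr_ge0.
have v0 : 0 <= v by rewrite invr_ge0.
have T1 : 1 <= T by rewrite ler1n.
have k0 : 0 <= k by rewrite mulr_ge0.
have kc0 : 0 <= kc by rewrite divr_ge0 // ltW.
have vN : v * N%:R = 1 by rewrite mulVf // lt0r_neq0.
have kcE : c2 * kc = k by rewrite mulrC mulfVK // lt0r_neq0.
have EW2 : `|Wk| <= N%:R ^+ 2 * (4 * kc * (T * a + 2 * u + T * v)).
  rewrite -(ler_pM2l c20); apply: le_trans EW _.
  have -> : c2 * (N%:R ^+ 2 * (4 * kc * (T * a + 2 * u + T * v))) =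
      4 * (c2 * kc) * N%:R * (N%:R * (T * a + 2 * u) + T * (v * N%:R)) by ring.
  rewrite kcE vN mulr1 /k -/u -/T.
  have -> : 4 * K * (Rt * N%:R) = 4 * (K * Rt) * N%:R by ring.
  rewrite ler_wpM2l ?mulr_ge0 // lerD2l ler_nat.
  by rewrite ltnS -addn2 leq_addr.
have IE : N%:R ^+ 2 * I = Wk - (Wk - J) + N%:R * Z by rewrite JE; ring.
have EI : N%:R ^+ 2 * `|I| <=
    N%:R ^+ 2 * (4 * kc * (T * a + 2 * u + T * v) + 4 * k * a + k * v).
  rewrite -[X in X * `|I|]ger0_norm ?exprn_ge0 // -normrM IE.
  apply: le_trans (ler_normD _ _) _; rewrite mulrDr; apply: lerD.
    apply: le_trans (ler_normB _ _) _; rewrite mulrDr; apply: lerD => //.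
    by apply: le_trans EJ _; rewrite le_eqVlt; apply/orP; left; apply/eqP; rewrite /k; ring.
  rewrite normrM normr_nat; apply: le_trans (ler_wpM2l (ltW NR) EZ) _.
  have -> : N%:R ^+ 2 * (k * v) = N%:R * k * (v * N%:R) by ring.
  by rewrite vN mulr1.
have {EI}EI : `|I| <= 4 * kc * (T * a + 2 * u + T * v) + 4 * k * a + k * v.
  by move: EI; rewrite ler_pM2l // exprn_gt0.
apply: le_trans EI _.
have -> : 8 * K * Rt / c2 + 4 * K * Rt = 8 * kc + 4 * k.
  by rewrite /kc /k; ring.
rewrite -/u -/v -/T.
have h1 := mulr_ge0 kc0 (mulr_ge0 (le_trans ler01 T1) a0).
have h2 := mulr_ge0 kc0 (mulr_ge0 (le_trans ler01 T1) v0).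
have h3 := mulr_ge0 k0 u0.
have h4 : k * a <= k * (T * a) by rewrite ler_wpM2l // ler_peMl.
have h5 : k * v <= k * (T * v) by rewrite ler_wpM2l // ler_peMl.
have h6 := mulr_ge0 k0 a0; have h7 := mulr_ge0 k0 v0; have h8 := mulr_ge0 kc0 u0.
by lra.
Qed.

End TestFunction.

(** * The limit on the second time scale *)

Section SecondTimeScale.
Variables (R : realType) (S : finType) (r : S -> S -> R) (d : nat -> R).
Variable mu : forall N, config S N -> R.
Arguments mu : clear implicits.
Variable A : {set S}.
Hypothesis r0 : forall x y, 0 <= r x y.
Hypothesis d_gt0 : forall N, 0 < d N.
Hypothesis mu_inv : forall N, invariant_prob r (d N) (mu N).
Hypothesis r_sym : forall x y, x \in A -> y \in A -> r x y = r y x.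
Hypothesis A_attracting : attracting r A.
Hypothesis cvg_A : (fun N => \sum_(x in A) mu N (xi N x)) @ \oo --> (1 : R).

Lemma cvg_rate_gen (f : S -> R) :
  (fun N => \sum_(x in A) mu N (xi N x) * chain_gen r A f x) @ \oo --> (0 : R).
Proof.
pose K := \sum_x `|f x|.
have K0 : 0 <= K by rewrite sumr_ge0.
have fK x : `|f x| <= K by rewrite /K (bigD1 x) //= lerDl sumr_ge0.
have [rho rho01 r_rho] := attracting_ratio r0 A_attracting.
have /andP[rho0 rho1] := rho01.
have r_out x y : x \in A -> y \notin A -> r x y <= r y x.
  move=> xA yA; apply: le_trans (r_rho _ _ xA yA) _.
  by rewrite ler_piMl // ltW.
have Rt0 := total_rate_ge0 r0.
(* The added 1 makes C positive even when [f] vanishes. *)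
pose C := 8 * K * total_rate r / (1 - rho) ^+ 2 + 4 * K * total_rate r + 1.
have C0 : 0 < C.
  rewrite /C ltr_wpDl // addr_ge0 ?mulr_ge0 // invr_ge0 exprn_ge0 // subr_ge0.
  exact: ltW.
apply/cvgr0Pnorm_lt => e e0.
(* M is fixed first, to make C / M < e / 2; then N tends to infinity and removes the terms carrying
   M + 3. *)
pose M := (Num.trunc (2 * C / e)).+1.
have CM : C * M%:R^-1 < e / 2.
  rewrite -ltr_pdivlMl // [X in _ < X](_ : _ = (2 * C / e)^-1).
    by rewrite ltf_pV2 ?posrE ?divr_gt0 ?mulr_gt0 // truncnS_gt.
  by rewrite !invfM invrK; ring.
have lim0 : (fun N : nat => C * (M.+3%:R * (defect (mu N) A + N%:R^-1)))
    @ \oo --> (0 : R).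
  rewrite [X in _ --> X](_ : 0 = C * (M.+3%:R * ((1 - 1) + 0))); last first.
    by rewrite subrr addr0 !mulr0.
  apply: cvgM; first exact: cvg_cst.
  apply: cvgM; first exact: cvg_cst.
  apply: cvgD; last exact: cvg_inv_nat.
  by apply: cvgB cvg_A; exact: cvg_cst.
have e2 : 0 < e / 2 by rewrite divr_gt0.
have [N0 _ HN0] := (cvgr0Pnorm_lt _).1 lim0 _ e2.
exists (maxn 1 N0) => // N /=; rewrite geq_max => /andP[N1 NN0].
have := HN0 N NN0 => /=; set t := M.+3%:R * _ => ht.
have ub := second_scale_estimate r0 fK K0 N1 r_sym r_out (d_gt0 N) (mu_inv N)
  rho01 r_rho (ltn0Sn _ : (0 < M)%N).
have t0 : 0 <= t.
  by rewrite mulr_ge0 // addr_ge0 ?invr_ge0 // (defect_ge0 A N1 (mu_inv N)).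
have m0 : 0 <= M%:R^-1 :> R by rewrite invr_ge0.
apply: le_lt_trans ub _; rewrite -/t.
have hC : C * t < e / 2 by apply: le_lt_trans (ler_norm _) ht.
by move: hC CM; rewrite /C; lra.
Qed.

End SecondTimeScale.

Theorem theorem3p13 (R : realType) (S : finType) (r : S -> S -> R)
  (d : nat -> R) (mu : forall N : nat, config S N -> R) :
  (forall x y, 0 <= r x y) ->
  (forall x, r x x = 0) ->
  (forall x y, connect (posrel r) x y) ->
  (forall N, 0 < d N) ->
  d @ \oo --> (0 : R) ->
  (fun N => d N * ln (N%:R)) @ \oo --> (0 : R) ->
  (forall N, invariant_prob r (d N) (mu N)) ->
  (fun N => \sum_(eta in EN S N) mu N eta) @ \oo --> (1 : R) ->
  (irreducible_on (brate r) (Szero r) ->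
     conclusion mu (Szero r) (brate r)) /\
  ((forall x y, x \in Szero r -> y \in Szero r -> r x y = r y x) ->
   irreducible_on r (Szero r) ->
   attracting r (Szero r) ->
     conclusion mu (Szero r) r).
Proof.
move=> r0 _ _ d0 cd cdln inv cond; split.
  exact: conclusion_brate r0 d0 cd cdln inv cond.
(* The first time scale still supplies the concentration on S_0; only the limiting generator is
   taken from the second. *)
move=> sym irr att; have cA := cvg_sum_Szero r0 d0 cd cdln inv cond.
apply: limit_chain => //.
- exact: (mu_xi_ge0 inv).
- exact: (cvg_transient r0 d0 cd cdln inv).
- exact: (cvg_rate_gen r0 d0 inv sym att cA).
Qed.
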